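(* Consider the multi-community preferential attachment model with types described in the context. Suppose that the type assignment rule satisfies the following properties. 1. $R$ has a unique fixed point $z^*\in[0,1]$, except possibly for linearly unstable fixed points at $0$ and/or $1$. 2. The only fixed points of $z\mapsto R(R(z))$ in $[0,1]$ are the fixed points of $R$. Then for all communities $i$ we have $Z^{(t)}_i\to z^*$ as $t\to\infty$, almost surely.
   Context: Model. $S=\{1,\dots,N\}$ is a finite set of communities, $m\ge 1$ is an integer, $\mu=(\mu_i)_{i\in S}$ is a probability distribution on $S$ with $\mu_i>0$ for all $i$, and $A=(\alpha_{x,y})_{x,y\in S}$ (the attractiveness matrix) has non-negative entries with $\sum_x\alpha_{x,y}>0$ for every $y$. The type assignment rule is given by $p_0,\dots,p_m\in[0,1]$. $G_0$ is a fixed finite initial (multi)graph with $n_0$ vertices and $mn_0$ edges, all vertices having positive degree; each vertex $v$ has a community $c(v)\in S$ and a type (colour), red or blue, and each community contains at least one vertex of $G_0$. Given $G_t$, the graph $G_{t+1}$ is obtained by adding a vertex $v_{t+1}$ whose community $c(v_{t+1})$ has law $\mu$, independently of everything else, and $m$ edges from $v_{t+1}$ to $m$ existing vertices chosen independently with replacement, each choice being equal to vertex $v$ with probability $$\frac{\alpha_{c(v),c(v_{t+1})}\deg_{G_t}(v)}{\sum_{u\in V(G_t)}\alpha_{c(u),c(v_{t+1})}\deg_{G_t}(u)}.$$ Then, conditional on exactly $k$ of the $m$ chosen neighbours (with multiplicity) being red, $v_{t+1}$ becomes red with probability $p_k$ and otherwise blue; types never change afterwards. $Z^{(t)}_i=\dfrac{\sum_{v\text{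 red},\,c(v)=i}\deg_{G_t}(v)}{\sum_{v:\,c(v)=i}\deg_{G_t}(v)}$ is the proportion of edge-ends in community $i$ at time $t$ which are at red vertices. The polynomial of the rule is $R(z)=\sum_{k=0}^m\binom mk z^k(1-z)^{m-k}p_k$. A fixed point of $R$ at $0$ is unstable if $R(y)>y$ for all $y\in(0,\eta)$ for some $\eta>0$; a fixed point at $1$ is unstable if $R(y)<y$ for all $y\in(1-\eta,1)$ for some $\eta>0$. An unstable fixed point $z$ is linearly unstable if $R'(z)>1$. Condition 1 means: $z^*$ is a fixed point of $R$ in $[0,1]$, and any other fixed point of $R$ in $[0,1]$ is at $0$ or $1$ and is linearly unstable.
   Formalization: Added: if 0 (resp. 1) is a fixed point of R other than z*, then every community y is linked, by a chain of communities with positive attractiveness, to one (possibly y) with a red (resp. blue) vertex of G_0; otherwise the claim fails, e.g. R(z)=2z(1-z) with G_0 all blue. *)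

(* Defs.v *)
From HB Require Import structures.
From mathcomp Require Import all_boot all_order all_algebra.
From mathcomp Require Import all_classical all_reals all_analysis.
Set Implicit Arguments.
Unset Strict Implicit.
Unset Printing Implicit Defensive.
Import Order.TTheory GRing.Theory Num.Theory.
Import numFieldNormedType.Exports.
Local Open Scope classical_set_scope.
Local Open Scope ring_scope.

(* A finite multigraph on the vertices 0, ..., nv - 1, in order of arrival.
   [vlabels] lists the (community, type) pair of each vertex, the type being
   [true] for red and [false] for blue; [edges] lists the edges with
   multiplicity.  Communities are numbered from 0. *)
Definition graph (N : nat) : Type := (seq ('I_N * bool) * seq (nat * nat))%type.

Section Graph.
Variable N : nat.
Implicit Types g : graph N.

Definition vlabels g : seq ('I_N * bool) := g.1.
Definition edges g : seq (nat * nat) := g.2.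
Definition nv g : nat := size (vlabels g).

Definition community g (v : 'I_(nv g)) : 'I_N := (tnth (in_tuple (vlabels g)) v).1.
Definition red g (v : 'I_(nv g)) : bool := (tnth (in_tuple (vlabels g)) v).2.

(* A loop counts twice. *)
Definition deg g (v : 'I_(nv g)) : nat :=
  (\sum_(e <- edges g) ((e.1 == v :> nat) + (e.2 == v :> nat)))%N.

Record initial_graph (m : nat) g : Prop := InitialGraph {
  ig_endpoints : forall e, e \in edges g -> (e.1 < nv g)%N /\ (e.2 < nv g)%N ;
  ig_edges : size (edges g) = (m * nv g)%N ;
  ig_deg : forall v : 'I_(nv g), (0 < deg v)%N ;
  ig_community : forall i : 'I_N, exists v : 'I_(nv g), community v = i }.

(* [f j] is the j-th chosen neighbour of the new vertex. *)
Definition add_vertex (m : nat) g (y : 'I_N) (f : {ffun 'I_m -> 'I_(nv g)})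
    (b : bool) : graph N :=
  (rcons (vlabels g) (y, b),
   edges g ++ [seq (nv g, nat_of_ord (f j)) | j <- enum 'I_m]).

End Graph.

Section Model.
Variables (R : realType) (N m : nat).
Implicit Types g : graph N.

Definition attach_prob (A : 'M[R]_N) g (y : 'I_N) (v : 'I_(nv g)) : R :=
  A (community v) y * (deg v)%:R /
  \sum_(u : 'I_(nv g)) A (community u) y * (deg u)%:R.

Definition nb_red g (f : {ffun 'I_m -> 'I_(nv g)}) : nat :=
  #|[set j : 'I_m | red (f j)]%SET|.

Definition type_prob (p : 'I_m.+1 -> R) (k : nat) (b : bool) : R :=
  if b then p (inord k) else 1 - p (inord k).

Definition step_prob (mu : 'I_N -> R) (A : 'M[R]_N) (p : 'I_m.+1 -> R)
    g (y : 'I_N) (f : {ffun 'I_m -> 'I_(nv g)}) (b : bool) : R :=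
  mu y * (\prod_(j < m) attach_prob A y (f j)) * type_prob p (nb_red f) b.

Definition history (T : Type) (G : nat -> T -> graph N) (t : nat)
    (h : nat -> graph N) : set T :=
  [set w | forall s, (s <= t)%N -> G s w = h s].

(* [pa_step] fixes the law of G: [add_vertex] is injective in (y, f, b) and
   the [step_prob] weights sum to 1 over the triples (y, f, b), so it says that
   the conditional law of G_{t+1} given G_0, ..., G_t is the prescribed one. *)
Record pa_process (mu : 'I_N -> R) (A : 'M[R]_N) (p : 'I_m.+1 -> R)
    (G0 : graph N) (d : measure_display) (T : measurableType d)
    (P : probability T R) (G : nat -> T -> graph N) : Prop := PaProcess {
  pa_measurable : forall t g, measurable [set w | G t w = g] ;
  pa_init : forall w, G 0%N w = G0 ;
  pa_step : forall (t : nat) (h : nat -> graph N) (y : 'I_N)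
      (f : {ffun 'I_m -> 'I_(nv (h t))}) (b : bool),
    P (history G t h `&` [set w | G t.+1 w = add_vertex y f b]) =
    (P (history G t h) * (step_prob mu A p y f b)%:E)%E }.

Definition red_share g (i : 'I_N) : R :=
  (\sum_(v : 'I_(nv g) | red v && (community v == i)) deg v)%N%:R /
  (\sum_(v : 'I_(nv g) | community v == i) deg v)%N%:R.

Definition rule_poly (p : 'I_m.+1 -> R) : {poly R} :=
  \sum_(k < m.+1) ('C(m, k)%:R * p k) *: ('X^k * (1 - 'X) ^+ (m - k)).

(* There is a red vertex of g in community y or in some community from which
   influence can propagate to y: new vertices of y attach to communities x with
   A x y > 0, those of x to communities x' with A x' x > 0, and so on.  Taking
   [b := false] gives the same for blue. *)
Definition type_reaches (A : 'M[R]_N) g (b : bool) (y : 'I_N) : Prop :=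
  exists v : 'I_(nv g),
    red v = b /\ connect (fun y' x => 0 < A x y') y (community v).

End Model.

Section FixedPoints.
Variable R : realType.
Implicit Types (q : {poly R}) (z : R).

Definition fixed_point01 q z : Prop := 0 <= z <= 1 /\ q.[z] = z.

Definition unstable q z : Prop :=
  fixed_point01 q z /\
  ((z = 0 /\ exists2 eta : R, 0 < eta &
      forall y, 0 < y < eta -> y < q.[y]) \/
   (z = 1 /\ exists2 eta : R, 0 < eta &
      forall y, 1 - eta < y < 1 -> q.[y] < y)).

Definition linearly_unstable q z : Prop := unstable q z /\ 1 < q^`().[z].

Definition unique_fixed_point q zstar : Prop :=
  fixed_point01 q zstar /\
  forall z, fixed_point01 q z -> z <> zstar ->
    (z = 0 \/ z = 1) /\ linearly_unstable q z.

Definition no_two_cycle q : Prop :=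
  forall z, 0 <= z <= 1 -> q.[q.[z]] = z -> fixed_point01 q z.

End FixedPoints.

(* Main.v *)
Require Import Defs.
From HB Require Import structures.
From mathcomp Require Import all_boot all_order all_algebra.
From mathcomp Require Import all_classical all_reals all_analysis.
From mathcomp Require Import zify ring lra.
Set Implicit Arguments.
Unset Strict Implicit.
Unset Printing Implicit Defensive.
Import Order.TTheory GRing.Theory Num.Theory.
Import numFieldNormedType.Exports.
Local Open Scope classical_set_scope.
Local Open Scope ring_scope.

(** Let [D_i] be the degree of community [i], [Z_i] its red share, and [W_i] the
    probability that a neighbour picked by a new vertex of community [i] is red:
    [W_i] is a weighted average of the shares.  On average [Z_i] moves by
    [gamma_i (R(W_i) - Z_i)] with [gamma_i = m mu_i / D_i], so that no
    information on the growth of [D_i] is needed beyond [D_i -> oo].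

    All noise terms are functions [X(G_t, G_(t+1))] with
    [X(g, g')^2 <= phi g - phi g'] for a potential [phi >= 0], a multiple of the
    inverse of a degree.  Hence the sum of their second moments is finite and, by
    Kolmogorov's inequality, the centred sums converge almost surely; the rest is
    deterministic.  If [a] and [b] are the limits inferior and superior of the
    shares over all communities, then [min R <= a] and [b <= max R] over [a, b];
    as [R] has no 2-cycle this forces [a = b = z*], unless [a = 0] or [b = 1] is
    an unstable fixed point.

    To exclude [a = 0] one uses that [log Z_i] moves by
    [gamma_i (R(W_i) / Z_i - 1)] up to a convergent noise, the noise of the
    logarithm of a red degree [r] being controlled by the potential [1 / r].
    Since [R(w) >= c w] near 0 with [c > 1] and [W_i >= min Z], the
    least of the logarithms cannot tend to [-oo].  The case [b = 1] is the same
    statement for the blue share, with [1 - R(1 - w)] in place of [R]. *)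

(** * Degrees of the new graph *)

Section Mass.
Variables (N m : nat).
Implicit Types (g : graph N) (Q : pred ('I_N * bool)).

Definition label g (v : 'I_(nv g)) : 'I_N * bool := tnth (in_tuple (vlabels g)) v.

Definition mass g Q : nat := \sum_(v : 'I_(nv g) | Q (label v)) deg v.

(** Edge ends are bare numbers, so labels are looked up by number, with [false] out of range;
    [initial_graph] guarantees that the ends of edges are in range. *)
Definition satisfies g Q (k : nat) : bool := nth false (map Q (vlabels g)) k.

Lemma satisfiesE g Q (v : 'I_(nv g)) : satisfies g Q v = Q (label v).
Proof.
rewrite /satisfies /label (tnth_nth (label v)) (nth_map (label v)) //.
Qed.

(** Double counting: once the two sums are exchanged, an edge end in range is counted at exactly one
    vertex. *)
Lemma mass_edges g Q :
  (forall e, e \in edges g -> (e.1 < nv g)%N /\ (e.2 < nv g)%N) ->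
  mass g Q = (\sum_(e <- edges g) (satisfies g Q e.1 + satisfies g Q e.2))%N.
Proof.
move=> ends.
have pick k : (k < nv g)%N ->
    (\sum_(v : 'I_(nv g) | Q (label v)) (k == v :> nat) = satisfies g Q k)%N.
  move=> ltk; rewrite -[k]/(nat_of_ord (Ordinal ltk)) satisfiesE.
  rewrite big_mkcond (bigD1 (Ordinal ltk)) //= eqxx big1 ?addn0.
    by case: ifP.
  move=> v /negPf nv; case: ifP => // _; rewrite -[k]/(nat_of_ord (Ordinal ltk)).
  by rewrite eq_sym val_eqE nv.
rewrite /mass /deg exchange_big /= big_seq [RHS]big_seq.
by apply: eq_bigr => e /ends[e1 e2]; rewrite big_split /= !pick.
Qed.

Lemma nv_add_vertex g (y : 'I_N) (f : {ffun 'I_m -> 'I_(nv g)}) (b : bool) :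
  nv (add_vertex y f b) = (nv g).+1.
Proof. by rewrite /nv /= size_rcons. Qed.

(** Old vertices keep their numbers and labels, so the mass changes only through the [m] new edges,
    each having one end at the new vertex and one at a pick. *)
Lemma mass_add_vertex g (y : 'I_N) (f : {ffun 'I_m -> 'I_(nv g)}) (b : bool) Q :
  initial_graph m g ->
  mass (add_vertex y f b) Q =
  (mass g Q + (m * Q (y, b) + \sum_(j < m) Q (label (f j))))%N.
Proof.
move=> [ends _ _ _].
have sat_old k : (k < nv g)%N ->
    satisfies (add_vertex y f b) Q k = satisfies g Q k.
  by move=> ltk; rewrite /satisfies /= map_rcons nth_rcons size_map ltk.
have sat_new : satisfies (add_vertex y f b) Q (nv g) = Q (y, b).
  by rewrite /satisfies /= map_rcons nth_rcons size_map ltnn eqxx.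
rewrite mass_edges; last first.
  move=> e; rewrite nv_add_vertex /= mem_cat => /orP[/ends[e1 e2]|/mapP[j _ ->]] /=.
    by split; apply: ltnW.
  by split; rewrite ltnS // ltnW.
rewrite mass_edges //= big_cat /=; congr (_ + _)%N.
  rewrite big_seq [RHS]big_seq.
  by apply: eq_bigr => e /ends[e1 e2]; rewrite !sat_old.
rewrite big_map big_enum /= big_split /= sat_new sum_nat_const card_ord.
congr (_ + _)%N; apply: eq_bigr => j _.
by rewrite sat_old // satisfiesE.
Qed.

Lemma mass_total g : initial_graph m g -> mass g predT = (2 * (m * nv g))%N.
Proof.
move=> [ends sz _ _]; rewrite mass_edges // -sz.
rewrite big_seq (eq_bigr (fun=> 2%N)) => [|e /ends[e1 e2]].
  by rewrite -big_seq big_const_seq count_predT iter_addn_0.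
by rewrite -[e.1]/(nat_of_ord (Ordinal e1)) -[e.2]/(nat_of_ord (Ordinal e2)) !satisfiesE.
Qed.

Lemma massE g Q : mass g Q = (\sum_(v : 'I_(nv g)) Q (label v) * deg v)%N.
Proof. by rewrite /mass big_mkcond; apply: eq_bigr => v _; case: (Q _); rewrite ?mul1n. Qed.

Lemma mass_le g Q Q' : subpred Q Q' -> (mass g Q <= mass g Q')%N.
Proof.
move=> QQ'; rewrite !massE leq_sum // => v _; rewrite leq_mul2r.
apply/orP; right; case E: (Q _) => //.
by rewrite (QQ' _ E).
Qed.

Lemma massU g Q Q' : (forall l, ~~ (Q l && Q' l)) ->
  mass g (fun l => Q l || Q' l) = (mass g Q + mass g Q')%N.
Proof.
move=> disj; rewrite !massE -big_split; apply: eq_bigr => v _ /=.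
by move: (disj (label v)); case: (Q _); case: (Q' _); rewrite ?mul1n ?addn0.
Qed.

(** This makes [initial_graph] an invariant of the process; [m] being positive gives the new vertex
    a positive degree. *)
Lemma initial_graph_add_vertex g (y : 'I_N) (f : {ffun 'I_m -> 'I_(nv g)}) b :
  (0 < m)%N -> initial_graph m g -> initial_graph m (add_vertex y f b).
Proof.
move=> m0 ig; have [ends sz dg cm] := ig.
have nth_old (v : 'I_(nv g)) (v' : 'I_(nv (add_vertex y f b))) :
    v = v' :> nat -> label v' = label v.
  move=> e; rewrite /label !(tnth_nth (label v)) /= nth_rcons.
  by rewrite -e ltn_ord.
split.
- move=> e; rewrite nv_add_vertex /= mem_cat => /orP[/ends[e1 e2]|/mapP[j _ ->]] /=.
    by split; apply: ltnW.
  by split; rewrite ltnS // ltnW.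
- by rewrite nv_add_vertex /= size_cat size_map size_enum_ord sz mulnS addnC.
- move=> v; rewrite /deg /= big_cat /=.
  have := ltn_ord v; rewrite {2}nv_add_vertex ltnS leq_eqVlt => /orP[/eqP vE|vlt].
    rewrite ltn_addl // big_map big_enum /= vE eqxx big_split /=.
    by rewrite sum_nat_const card_ord muln1 ltn_addr.
  exact: ltn_addr (dg (Ordinal vlt)).
- move=> i; have [v <-] := cm i.
  have lv : (v < nv (add_vertex y f b))%N by rewrite nv_add_vertex ltnW // ltnS.
  exists (Ordinal lv); rewrite /community.
  by rewrite -/(label v) -/(label (Ordinal lv)) (nth_old v).
Qed.

End Mass.

(** * One-step expectations *)

(** The number of successes among [m] independent picks is binomial, here for weights of arbitrary
    total. Maps are grouped by their set of successful indices; over one such set the sum of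
    products factors, and the sets are then counted by cardinality. *)
Lemma sum_ffun_prod_count (R : comNzRingType) (V : finType) (m : nat)
    (w : V -> R) (r : pred V) (phi : nat -> R) :
  \sum_(f : {ffun 'I_m -> V}) (\prod_j w (f j)) * phi #|[set j | r (f j)]%SET| =
  \sum_(k < m.+1) 'C(m, k)%:R * (\sum_(v | r v) w v) ^+ k *
    (\sum_(v | ~~ r v) w v) ^+ (m - k) * phi k.
Proof.
rewrite (partition_big (fun f : {ffun 'I_m -> V} => [set j | r (f j)]%SET) predT) //=.
have fiber (B : {set 'I_m}) :
    \sum_(f : {ffun 'I_m -> V} | [set j | r (f j)]%SET == B)
      (\prod_j w (f j)) * phi #|[set j | r (f j)]%SET| =
    (\sum_(v | r v) w v) ^+ #|B| * (\sum_(v | ~~ r v) w v) ^+ (m - #|B|) * phi #|B|.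
  rewrite (eq_bigr (fun f : {ffun 'I_m -> V} => (\prod_j w (f j)) * phi #|B|)); last first.
    by move=> f /eqP->.
  rewrite -mulr_suml; congr (_ * _).
  rewrite (eq_bigl (mem (family (fun j : 'I_m => [pred v | r v == (j \in B)])))); last first.
    move=> f; apply/eqP/familyP => [<- j|fB].
      by rewrite !inE.
    by apply/setP => j; rewrite !inE; have := fB j; rewrite inE => /eqP.
  rewrite -(bigA_distr_big_dep (fun (j : 'I_m) v => r v == (j \in B)) (fun _ => w)) /=.
  rewrite (bigID (mem B)) /=; congr (_ * _).
    rewrite -prodr_const; apply: eq_bigr => j jB; apply: eq_bigl => v.
    by rewrite jB eqb_id.
  have -> : (m - #|B| = #|~: B|)%N by have := cardsC B; rewrite card_ord; lia.
  rewrite -prodr_const; apply: eq_big => [j|j jB]; first by rewrite inE.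
  by apply: eq_bigl => v; rewrite (negPf jB) eqbF_neg.
rewrite (eq_bigr _ (fun B _ => fiber B)).
have cardB (B : {set 'I_m}) : (#|B| < m.+1)%N.
  by rewrite ltnS -[X in (_ <= X)%N]card_ord max_card.
rewrite (partition_big (fun B : {set 'I_m} => Ordinal (cardB B)) predT) //=.
apply: eq_bigr => k _.
rewrite (eq_bigr (fun=> (\sum_(v | r v) w v) ^+ k *
    (\sum_(v | ~~ r v) w v) ^+ (m - k) * phi k)) => [|B /eqP<- //].
rewrite sumr_const -[LHS]mulr_natl -!mulrA; congr (_%:R * _).
rewrite -[X in 'C(X, _)]card_ord -card_draws; apply: eq_card => B.
by rewrite [in RHS]inE.
Qed.

Section Kernel.
Variables (R : realType) (N m : nat) (mu : 'I_N -> R) (A : 'M[R]_N).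
Variable p : 'I_m.+1 -> R.
Hypotheses (m_gt0 : (0 < m)%N) (mu_gt0 : forall i, 0 < mu i).
Hypothesis mu_sum1 : \sum_(i < N) mu i = 1.
Hypotheses (A_ge0 : forall x y, 0 <= A x y) (A_sum_gt0 : forall y, 0 < \sum_(x < N) A x y).
Hypothesis p01 : forall k, 0 <= p k <= 1.
Implicit Types (g : graph N) (Q : pred ('I_N * bool)).

Let rule (w : R) : R := (rule_poly p).[w].

Lemma rule_polyE w :
  rule w = \sum_(k < m.+1) 'C(m, k)%:R * w ^+ k * (1 - w) ^+ (m - k) * p k.
Proof.
rewrite /rule /rule_poly horner_sum; apply: eq_bigr => k _.
by rewrite !hornerE /=; ring.
Qed.

Definition attach_weight g y : R := \sum_(u : 'I_(nv g)) A (community u) y * (deg u)%:R.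

Definition pick_prob g y Q : R := \sum_(v : 'I_(nv g) | Q (label v)) attach_prob A y v.

Definition in_comm (i : 'I_N) : pred ('I_N * bool) := fun l => l.1 == i.
Definition in_type (b : bool) : pred ('I_N * bool) := fun l => l.2 == b.
Definition in_part (i : 'I_N) (b : bool) : pred ('I_N * bool) :=
  fun l => (l.1 == i) && (l.2 == b).

Lemma mass_sumE g Q : (mass g Q)%:R = \sum_(v : 'I_(nv g) | Q (label v)) (deg v)%:R :> R.
Proof. by rewrite /mass natr_sum. Qed.

Lemma sum_labels g Q y :
  \sum_(v : 'I_(nv g) | Q (label v)) A (community v) y * (deg v)%:R =
  \sum_x A x y * (mass g (fun l => Q l && in_comm x l))%:R.
Proof.
rewrite (partition_big (fun v : 'I_(nv g) => community v) predT) //=.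
apply: eq_bigr => x _; rewrite mass_sumE mulr_sumr.
by apply: eq_big => [v|v /andP[_ /eqP->]] //.
Qed.

Lemma attach_weightE g y : attach_weight g y = \sum_x A x y * (mass g (in_comm x))%:R.
Proof. exact: (@sum_labels g predT). Qed.

Lemma comm_mass_gt0 g i : initial_graph m g -> (0 < mass g (in_comm i))%N.
Proof.
move=> [_ _ dg cm]; have [v vi] := cm i; rewrite /mass.
rewrite (bigD1 v) /=; last by apply/eqP.
by rewrite ltn_addr.
Qed.

(** Every community has degree at least 1, so the weight dominates a column sum of [A]. *)
Lemma attach_weight_gt0 g y : initial_graph m g -> 0 < attach_weight g y.
Proof.
move=> ig; rewrite attach_weightE; apply: lt_le_trans (A_sum_gt0 y) _.
apply: ler_sum => x _; rewrite ler_peMr //.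
by rewrite ler1n comm_mass_gt0.
Qed.

Lemma attach_prob_ge0 g y (v : 'I_(nv g)) : initial_graph m g -> 0 <= attach_prob A y v.
Proof.
move=> ig; rewrite /attach_prob divr_ge0 ?mulr_ge0 //.
exact/ltW/attach_weight_gt0.
Qed.

Lemma pick_probE g y Q :
  pick_prob g y Q =
  (\sum_x A x y * (mass g (fun l => Q l && in_comm x l))%:R) / attach_weight g y.
Proof. by rewrite -sum_labels /pick_prob -mulr_suml. Qed.

Lemma pick_prob_predT g y : initial_graph m g -> pick_prob g y predT = 1.
Proof.
move=> ig; rewrite pick_probE -(attach_weightE g y) divff //.
by rewrite gt_eqF ?attach_weight_gt0.
Qed.

Lemma pick_probC g y Q : initial_graph m g ->
  pick_prob g y (predC Q) = 1 - pick_prob g y Q.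
Proof.
move=> ig; rewrite -(pick_prob_predT y ig) /pick_prob [in RHS](bigID (fun v => Q (label v))) /=.
by rewrite addrAC subrr add0r.
Qed.

Definition type_rule (b : bool) (w : R) : R := if b then rule w else 1 - rule w.

Definition red_pick g y : R := pick_prob g y (in_type true).

(** Expectation under the law of one step. It is a finite sum over the choices, so conditional
    expectations are handled without integrals. *)
Definition step_mean g (H : forall y : 'I_N, {ffun 'I_m -> 'I_(nv g)} -> bool -> R) : R :=
  \sum_y \sum_(f : {ffun 'I_m -> 'I_(nv g)}) \sum_b step_prob mu A p y f b * H y f b.

Lemma step_prob_ge0 g y (f : {ffun 'I_m -> 'I_(nv g)}) b :
  initial_graph m g -> 0 <= step_prob mu A p y f b.
Proof.
move=> ig; rewrite /step_prob !mulr_ge0 //; first exact/ltW.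
  by apply: prodr_ge0 => j _; apply: attach_prob_ge0.
by case: b => /=; have /andP[] := p01 (inord (nb_red f)); rewrite ?subr_ge0.
Qed.

Lemma sum_type_prob k : \sum_b type_prob p k b = 1.
Proof. by rewrite big_bool /= addrC subrK. Qed.

Lemma sum_ffun_attach g y (phi : nat -> R) : initial_graph m g ->
  \sum_(f : {ffun 'I_m -> 'I_(nv g)}) (\prod_(j < m) attach_prob A y (f j)) * phi (nb_red f) =
  \sum_(k < m.+1) 'C(m, k)%:R * red_pick g y ^+ k * (1 - red_pick g y) ^+ (m - k) * phi k.
Proof.
move=> ig; rewrite /nb_red (sum_ffun_prod_count m (attach_prob A y) (@red N g)).
apply: eq_bigr => k _; rewrite -pick_probC //; congr (_ * _ ^+ _ * _ ^+ _ * _).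
  by apply: eq_bigl => v; rewrite /in_type eqb_id.
by apply: eq_bigl => v; rewrite /= /in_type eqb_id.
Qed.

Lemma sum_binomial (w : R) :
  \sum_(k < m.+1) 'C(m, k)%:R * w ^+ k * (1 - w) ^+ (m - k) = 1.
Proof.
rewrite -[RHS](expr1n _ m) -[X in _ = X ^+ m](subrK w) exprDn.
by apply: eq_bigr => k _; rewrite -[RHS]mulr_natl; ring.
Qed.

Lemma type_ruleE b (w : R) :
  \sum_(k < m.+1) 'C(m, k)%:R * w ^+ k * (1 - w) ^+ (m - k) * type_prob p k b = type_rule b w.
Proof.
case: b; rewrite /= rule_polyE; first by apply: eq_bigr => k _; rewrite inord_val.
rewrite -[X in _ = X - _](sum_binomial w) -sumrB; apply: eq_bigr => k _.
by rewrite inord_val; ring.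
Qed.

(** Given the new community, the type depends on the picks only through the number of red ones,
    which is binomial; summing over the picks produces the polynomial of the rule. *)
Lemma step_mean_label g (h : 'I_N -> bool -> R) : initial_graph m g ->
  @step_mean g (fun y _ b => h y b) =
  \sum_y mu y * \sum_b type_rule b (red_pick g y) * h y b.
Proof.
move=> ig; apply: eq_bigr => y _; rewrite exchange_big mulr_sumr; apply: eq_bigr => b _ /=.
rewrite -type_ruleE -(sum_ffun_attach y (fun k => type_prob p k b)) // mulrA mulr_sumr mulr_suml.
by apply: eq_bigr => f _; rewrite /step_prob; ring.
Qed.

Lemma sum_attach g y : initial_graph m g -> \sum_(v : 'I_(nv g)) attach_prob A y v = 1.
Proof. exact: pick_prob_predT. Qed.

Lemma step_mean_picks g (h : 'I_(nv g) -> R) : initial_graph m g ->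
  step_mean (fun _ f _ => \sum_(j < m) h (f j)) =
  \sum_y mu y * (m%:R * \sum_v attach_prob A y v * h v).
Proof.
move=> ig; apply: eq_bigr => y _.
pose w (v : 'I_(nv g)) := attach_prob A y v.
transitivity (\sum_(f : {ffun 'I_m -> 'I_(nv g)})
    mu y * ((\prod_(j < m) w (f j)) * \sum_(j < m) h (f j))).
  apply: eq_bigr => f _; rewrite -mulr_suml /step_prob -mulr_sumr sum_type_prob mulr1.
  by rewrite mulrA.
rewrite -mulr_sumr; congr (_ * _).
(* [h (f j)] is spread over all indices as a product of factors equal to 1 except at [j]. The sum
   over [f] then becomes a product of sums, all equal to 1 but the one at [j]. *)
transitivity (\sum_(j < m) \sum_(f : {ffun 'I_m -> 'I_(nv g)})
    \prod_(i < m) (w (f i) * (if i == j then h (f i) else 1))).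
  rewrite exchange_big /=; apply: eq_bigr => f _; rewrite mulr_sumr; apply: eq_bigr => j _.
  rewrite [RHS]big_split /= [X in _ = _ * X](bigD1 j) //= eqxx [X in _ = _ * (_ * X)]big1 ?mulr1 //.
  by move=> i /negPf->.
have -> c : m%:R * c = \sum_(j < m) c :> R by rewrite sumr_const card_ord mulr_natl.
apply: eq_bigr => j _.
rewrite -(bigA_distr_bigA (fun i v => w v * (if i == j then h v else 1))) /=.
rewrite (bigD1 j) //= eqxx [X in _ * X]big1 ?mulr1 // => i /negPf->.
by rewrite -mulr_suml mulr1 sum_attach.
Qed.

Lemma step_meanD g H1 H2 :
  step_mean (fun y (f : {ffun 'I_m -> 'I_(nv g)}) b => H1 y f b + H2 y f b) =
  step_mean H1 + step_mean H2.
Proof.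
rewrite /step_mean -big_split; apply: eq_bigr => y _; rewrite -big_split.
by apply: eq_bigr => f _; rewrite -big_split; apply: eq_bigr => b _; rewrite mulrDr.
Qed.

Lemma step_meanZ g c H :
  step_mean (fun y (f : {ffun 'I_m -> 'I_(nv g)}) b => c * H y f b) = c * step_mean H.
Proof.
rewrite /step_mean mulr_sumr; apply: eq_bigr => y _; rewrite mulr_sumr.
apply: eq_bigr => f _; rewrite mulr_sumr; apply: eq_bigr => b _; ring.
Qed.

Lemma step_mean_le g H1 H2 : initial_graph m g ->
  (forall y (f : {ffun 'I_m -> 'I_(nv g)}) b, H1 y f b <= H2 y f b) ->
  step_mean H1 <= step_mean H2.
Proof.
move=> ig le; apply: ler_sum => y _; apply: ler_sum => f _; apply: ler_sum => b _.
by rewrite ler_wpM2l // step_prob_ge0.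
Qed.

Lemma eq_step_mean g H1 H2 :
  (forall y (f : {ffun 'I_m -> 'I_(nv g)}) b, H1 y f b = H2 y f b) ->
  step_mean H1 = step_mean H2.
Proof.
move=> e; apply: eq_bigr => y _; apply: eq_bigr => f _; apply: eq_bigr => b _.
by rewrite e.
Qed.

Lemma type_rule_sum w : \sum_b type_rule b w = 1.
Proof. by rewrite big_bool /= addrC subrK. Qed.

Lemma step_mean_cst g c : initial_graph m g ->
  step_mean (fun y (f : {ffun 'I_m -> 'I_(nv g)}) b => c) = c.
Proof.
move=> ig; rewrite (step_mean_label (fun _ _ => c)) // -[RHS]mul1r -mu_sum1 mulr_suml.
by apply: eq_bigr => y _; rewrite -mulr_suml type_rule_sum mul1r.
Qed.

(** Expected number of picks in one step per unit of degree in community [i]. It is the same for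
    both types, hence cancels from the drifts of shares and of their logarithms. *)
Definition pick_rate g i : R := m%:R * \sum_y mu y * (A i y / attach_weight g y).

(** There are two sources of growth: the [m] own ends of a new vertex falling in this part, and the
    picks, which are proportional to the present degree. *)
Lemma step_mean_mass g i b : initial_graph m g ->
  step_mean (fun y (f : {ffun 'I_m -> 'I_(nv g)}) c =>
    (mass (add_vertex y f c) (in_part i b))%:R - (mass g (in_part i b))%:R) =
  m%:R * mu i * type_rule b (red_pick g i) + (mass g (in_part i b))%:R * pick_rate g i.
Proof.
move=> ig.
rewrite (@eq_step_mean _ _ (fun y (f : {ffun 'I_m -> 'I_(nv g)}) c =>
   m%:R * (in_part i b (y, c))%:R + \sum_(j < m) (in_part i b (label (f j)))%:R)); last first.
  by move=> y f c; rewrite mass_add_vertex // natrD addrAC subrr add0r natrD natrM natr_sum.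
rewrite step_meanD (step_mean_label (fun y c => m%:R * (in_part i b (y, c))%:R)) //.
rewrite (@step_mean_picks g (fun v => (in_part i b (label v))%:R)) //.
congr (_ + _).
  rewrite (bigD1 i) //= [X in _ + X]big1 ?addr0; last first.
    move=> y /negPf yi; rewrite big1 ?mulr0 // => c _.
    by rewrite /in_part /= yi !mulr0.
  rewrite (bigD1 b) //= [X in _ + X]big1 ?addr0; last first.
    by move=> c /negPf cb; rewrite /in_part /= cb andbF !mulr0.
  by rewrite /in_part /= !eqxx /=; ring.
rewrite /pick_rate mulrA mulr_sumr; apply: eq_bigr => y _; rewrite [RHS]mulrCA; congr (_ * _).
rewrite [(mass _ _)%:R * _]mulrC -mulrA; congr (_ * _).
have -> : \sum_(v : 'I_(nv g)) attach_prob A y v * (in_part i b (label v))%:R =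
    pick_prob g y (in_part i b).
  rewrite /pick_prob [RHS]big_mkcond; apply: eq_bigr => v _.
  by case: ifP; rewrite ?mulr1 ?mulr0.
rewrite pick_probE mulrA; congr (_ / _).
rewrite (bigD1 i) //= big1 ?addr0; last first.
  move=> x /negPf xi; rewrite /mass big_pred0 ?mulr0 // => v.
  rewrite /in_part /in_comm; case: eqP => //= ->; rewrite [i == x]eq_sym xi.
  by rewrite andbF.
rewrite mulrC; congr (_%:R * _).
by apply: eq_bigl => v; rewrite /in_part /in_comm; case: eqP; rewrite ?andbT.
Qed.

End Kernel.

(** * Almost sure convergence of the noise *)

Section Process.
Variables (R : realType) (N m : nat) (mu : 'I_N -> R) (A : 'M[R]_N).
Variable p : 'I_m.+1 -> R.
Hypotheses (m_gt0 : (0 < m)%N) (mu_gt0 : forall i, 0 < mu i).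
Hypothesis mu_sum1 : \sum_(i < N) mu i = 1.
Hypotheses (A_ge0 : forall x y, 0 <= A x y) (A_sum_gt0 : forall y, 0 < \sum_(x < N) A x y).
Hypothesis p01 : forall k, 0 <= p k <= 1.
Variables (G0 : graph N) (d : measure_display) (T : measurableType d) (P : probability T R).
Variable G : nat -> T -> graph N.
Hypotheses (G0_init : initial_graph m G0) (hG : pa_process mu A p G0 P G).
Implicit Types (g : graph N) (h : nat -> graph N) (E : set T).

Definition extend h t g : nat -> graph N := fun s => if s == t.+1 then g else h s.

Lemma extendE h t g : extend h t g t.+1 = g.
Proof. by rewrite /extend eqxx. Qed.

Lemma history_extend h t g :
  history G t.+1 (extend h t g) = history G t h `&` [set w | G t.+1 w = g].
Proof.
apply/seteqP; split=> w /= => [H|[H e] s].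
  split; last by rewrite (H t.+1) // extendE.
  by move=> s st; rewrite (H s (leqW st)) /extend ltn_eqF.
rewrite leq_eqVlt => /predU1P[->|st]; first by rewrite extendE.
by rewrite /extend ltn_eqF // H.
Qed.

Lemma measurable_state t g : measurable [set w | G t w = g].
Proof. exact: (pa_measurable hG). Qed.

Lemma measurable_history t h : measurable (history G t h).
Proof.
elim: t => [|t IH].
  rewrite (_ : history G 0 h = [set w | G 0%N w = h 0%N]); first exact: measurable_state.
  apply/seteqP; split=> w /=; first exact.
  by move=> e s; rewrite leqn0 => /eqP->.
rewrite (_ : history G t.+1 h = history G t.+1 (extend h t (h t.+1))).
  by rewrite history_extend; apply: measurableI => //; exact: measurable_state.
by apply/seteqP; split=> w /= H s st; rewrite H // /extend; case: eqP => // ->.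
Qed.

Lemma add_vertex_inj g (k k' : 'I_N * {ffun 'I_m -> 'I_(nv g)} * bool) :
  add_vertex k.1.1 k.1.2 k.2 = add_vertex k'.1.1 k'.1.2 k'.2 -> k = k'.
Proof.
case: k k' => [[y f] b] [[y' f'] b'] e.
case: (rcons_inj (congr1 fst e)) => /= -> ->.
move: (congr1 snd e) => /= /eqP; rewrite eqseq_cat // eqxx /= => /eqP /eq_in_map ef.
congr (_, _, _); apply/ffunP => j; apply: val_inj.
by have := ef j; rewrite mem_enum => /(_ isT) [].
Qed.

(* The triples (y, f, b) exhaust the history up to a null set because the step
   probabilities sum to 1 and [add_vertex] is injective. *)
Lemma step_mean_bound t h E (B : graph N -> R) :
  initial_graph m (h t) -> measurable E ->
  (forall y (f : {ffun 'I_m -> 'I_(nv (h t))}) b,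
    (P (history G t.+1 (extend h t (add_vertex y f b)) `&` E) <=
     P (history G t.+1 (extend h t (add_vertex y f b))) * (B (add_vertex y f b))%:E)%E) ->
  (P (history G t h `&` E) <= P (history G t h) *
    (step_mean mu A p (fun y (f : {ffun 'I_m -> 'I_(nv (h t))}) b => B (add_vertex y f b)))%:E)%E.
Proof.
move=> ig mE bnd.
pose K := ('I_N * {ffun 'I_m -> 'I_(nv (h t))} * bool)%type.
pose H := history G t h.
pose next (k : K) := add_vertex k.1.1 k.1.2 k.2.
pose S (k : K) : set T := [set w | G t.+1 w = next k].
have mS k : measurable (S k) by exact: measurable_state.
have mH : measurable H by exact: measurable_history.
pose U : set T := \big[setU/set0]_(j < #|{: K}|) S (enum_val j).
have split_sum (F : set T) : measurable F ->
    P (F `&` U) = (\sum_(k : K) P (F `&` S k))%E.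
  move=> mF; rewrite /U big_distrr /= (measure_bigsetU_ord P xpredT).
  - by rewrite [RHS](big_enum_val (fun k => P (F `&` S k))).
  - by move=> j; apply: measurableI.
  - move=> j j' _ _ [w [[_ /= e1] [_ e2]]]; apply: enum_val_inj; apply: add_vertex_inj.
    by rewrite -/(next (enum_val j)) -e1 e2.
have mU : measurable U by apply: bigsetU_measurable.
pose sp (k : K) := step_prob mu A p k.1.1 k.1.2 k.2.
have PHS k : P (H `&` S k) = (P H * (sp k)%:E)%E by exact: (pa_step hG).
have sum_sp (F : K -> R) : \sum_(k : K) sp k * F k =
    step_mean mu A p (fun y (f : {ffun 'I_m -> 'I_(nv (h t))}) b => F (y, f, b)).
  by rewrite /step_mean !pair_bigA /=; apply: eq_bigr => -[[y f] b].
have Pfin (F : set T) : measurable F -> P F = (fine (P F))%:E.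
  by move=> mF; rewrite fineK // fin_num_measure.
have full : P (H `&` U) = P H.
  rewrite split_sum // (eq_bigr (fun k => (fine (P H) * sp k)%:E)).
    rewrite sumEFin -mulr_sumr Pfin //.
    rewrite (eq_bigr (fun k => sp k * 1)) => [|k _]; last by rewrite mulr1.
    by rewrite (sum_sp (fun=> 1)) (step_mean_cst p mu_sum1 A_ge0 A_sum_gt0) // mulr1.
  by move=> k _; rewrite PHS [RHS]EFinM -(Pfin _ mH).
have rest : P ((H `&` E) `\` U) = 0%E.
  apply/eqP; rewrite eq_le measure_ge0 andbT.
  have <- : P (H `\` U) = 0%E.
    rewrite measureD //; last by rewrite ltey_eq fin_num_measure.
    by rewrite [X in (_ - X)%E]full subee // fin_num_measure.
  apply: le_measure; rewrite ?inE; [|by apply: measurableD|].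
    by apply: measurableD => //; apply: measurableI.
  by move=> w [[Hw _] nS]; split.
rewrite (measureDI (P : {content set T -> \bar R}) (B := U)) //; last exact: measurableI.
rewrite [X in (X + _)%E]rest add0e [X in (X <= _)%E]split_sum; last exact: measurableI.
rewrite -(sum_sp (fun k => B (next k))) Pfin // -EFinM mulr_sumr -sumEFin.
apply: lee_sum => k _; rewrite setIAC.
have := bnd k.1.1 k.1.2 k.2; rewrite /= history_extend -/(S k) -/H PHS => /le_trans; apply.
by rewrite (Pfin _ mH) -EFinM [X in (_ <= X)%E](_ : _ = (fine (P H) * sp k * B (next k))%:E) //= mulrA.
Qed.

(** Finite graphs form a countable type, so any relation between two states is a countable union of
    measurable events. *)
Lemma measurable_transition (B : graph N -> graph N -> Prop) s t :
  measurable [set w | B (G s w) (G t w)].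
Proof.
rewrite (_ : [set _ | _] = \bigcup_g \bigcup_g'
    ([set w | B g g'] `&` ([set w | G s w = g] `&` [set w | G t w = g']))).
  have cG : countable [set: graph N].
    exact: (@countableP _ [set: (seq ('I_N * bool) * seq (nat * nat))]).
  apply: countable_bigcupT_measurable => // g; apply: countable_bigcupT_measurable => // g'.
  apply: measurableI; last by apply: measurableI; exact: measurable_state.
  have [b|nb] := pselect (B g g');
    [rewrite (_ : [set _ | _] = setT) //|rewrite (_ : [set _ | _] = set0) //].
    by apply/seteqP; split.
  by apply/seteqP; split.
apply/seteqP; split=> w /=; first by move=> b; exists (G s w) => //; exists (G t w).
by move=> [g _ [g' _ [b [-> ->]]]].
Qed.

Definition transition g g' : Prop :=
  exists y (f : {ffun 'I_m -> 'I_(nv g)}) b, g' = add_vertex y f b.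

Section Noise.
Variable X : graph N -> graph N -> R.

Definition cond_mean g : R :=
  step_mean mu A p (fun y (f : {ffun 'I_m -> 'I_(nv g)}) b => X g (add_vertex y f b)).

Definition noise (t : nat) (w : T) : R := X (G t w) (G t.+1 w) - cond_mean (G t w).

(** Expected sum of the squares of [X] over the next [k] steps, as an iterated one-step mean;
    [delayed_energy] leaves out the first [s] steps and counts the [k] following ones. *)
Fixpoint energy k g : R :=
  if k is k'.+1 then step_mean mu A p (fun y (f : {ffun 'I_m -> 'I_(nv g)}) b =>
    X g (add_vertex y f b) ^+ 2 + energy k' (add_vertex y f b)) else 0.

Fixpoint delayed_energy s k g : R :=
  if s is s'.+1 then step_mean mu A p (fun y (f : {ffun 'I_m -> 'I_(nv g)}) b =>
    delayed_energy s' k (add_vertex y f b)) else energy k g.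

Lemma energyD s k g : energy (s + k) g = energy s g + delayed_energy s k g.
Proof.
elim: s g => [|s IH] g; first by rewrite add0n add0r.
rewrite addSn /= -step_meanD; apply: eq_step_mean => y f b.
by rewrite IH addrA.
Qed.

(** The squares are dominated by the decrements of [phi], which telescope. *)
Lemma energy_le (phi : graph N -> R) : (forall g, initial_graph m g -> 0 <= phi g) ->
  (forall g y (f : {ffun 'I_m -> 'I_(nv g)}) b, initial_graph m g ->
    X g (add_vertex y f b) ^+ 2 <= phi g - phi (add_vertex y f b)) ->
  forall k g, initial_graph m g -> energy k g <= phi g.
Proof.
move=> phi0 phiX; elim=> [|k IH] g ig; first exact: phi0.
rewrite -[leRHS](step_mean_cst p mu_sum1 A_ge0 A_sum_gt0 _ ig).
apply: step_mean_le => // y f b.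
by rewrite -lerBrDr (le_trans (phiX _ _ _ _ ig)) // lerB // IH //; apply: initial_graph_add_vertex.
Qed.

Lemma energy_ge0 k g : initial_graph m g -> 0 <= energy k g.
Proof.
elim: k g => [//|k IH] g ig /=.
rewrite -[leLHS](step_mean_cst p mu_sum1 A_ge0 A_sum_gt0 _ ig).
apply: step_mean_le => // y f b; rewrite addr_ge0 ?sqr_ge0 // IH //.
exact: initial_graph_add_vertex.
Qed.

Lemma delayed_energy_ge0 s k g : initial_graph m g -> 0 <= delayed_energy s k g.
Proof.
elim: s g => [|s IH] g ig /=; first exact: energy_ge0.
rewrite -[leLHS](step_mean_cst p mu_sum1 A_ge0 A_sum_gt0 _ ig).
by apply: step_mean_le => // y f b; rewrite IH //; exact: initial_graph_add_vertex.
Qed.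

(** Centring removes the cross term, and a variance is at most the second moment. *)
Lemma step_mean_sqr_noise x k g : initial_graph m g ->
  step_mean mu A p (fun y (f : {ffun 'I_m -> 'I_(nv g)}) b =>
    (x + (X g (add_vertex y f b) - cond_mean g)) ^+ 2 + energy k (add_vertex y f b)) <=
  x ^+ 2 + energy k.+1 g.
Proof.
move=> ig; set c := cond_mean g.
rewrite (@eq_step_mean _ _ _ _ _ _ _ _ (fun y (f : {ffun 'I_m -> 'I_(nv g)}) b =>
  (X g (add_vertex y f b) ^+ 2 + energy k (add_vertex y f b)) +
  (2 * (x - c) * X g (add_vertex y f b) + (x - c) ^+ 2))); last first.
  by move=> y f b; ring.
rewrite !step_meanD step_meanZ (step_mean_cst p mu_sum1 A_ge0 A_sum_gt0 _ ig) -/(cond_mean g) -/c.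
rewrite /= step_meanD addrC lerD2r.
have := sqr_ge0 c; nra.
Qed.

(** The index [j = 0] counts: if the start [x] is large the maximal inequality is trivial, and
    otherwise the event passes to the next time with the start moved by one noise term. *)
Definition exceeds (lam : R) t k x : set T :=
  [set w | exists2 j, (j <= k)%N & lam <= `|x + \sum_(u < j) noise (t + u)%N w| ].

Lemma measurable_noise t : measurable_fun setT (noise t).
Proof.
move=> _ Y _; rewrite setTI.
exact: (measurable_transition (fun g g' => Y (X g g' - cond_mean g))).
Qed.

Lemma measurable_exceeds lam t k x : measurable (exceeds lam t k x).
Proof.
rewrite (_ : exceeds _ _ _ _ =
   \bigcup_(j in [set j | (j <= k)%N])
     [set w | lam <= `|x + \sum_(u < j) noise (t + u)%N w|]); last first.
  by apply/seteqP; split=> w /= [j]; exists j.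
apply: bigcup_measurable => j _; rewrite -[X in measurable X]setTI.
apply: measurable_fun_le => //.
apply: measurableT_comp; first exact: measurable_realfun.normr_measurable.
apply: measurable_realfun.measurable_funD; first exact: measurable_cst.
by apply: measurable_sum => u; exact: measurable_noise.
Qed.

(* Kolmogorov's inequality for the noise after time [t], conditionally on the
   history and with the partial sums started at [x], by backward induction. *)
Lemma exceeds_le lam t h k x : 0 < lam -> initial_graph m (h t) ->
  (P (history G t h `&` exceeds lam t k x) <=
   P (history G t h) * (lam ^- 2 * (x ^+ 2 + energy k (h t)))%:E)%E.
Proof.
move=> lam0; elim: k t h x => [|k IH] t h x ig; have [lx|xl] := leP lam `|x|.
- apply: le_trans (measureIl _ _ _) _ => //;
    [exact: measurable_history|exact: measurable_exceeds|].
  rewrite -[leLHS]mule1; apply: lee_wpmul2l => //.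
  rewrite lee_fin mulrC ler_pdivlMr ?exprn_gt0 // mul1r ler_wpDr ?energy_ge0 //.
  by rewrite -(real_normK (num_real x)) lerXn2r ?nnegrE // ltW.
- rewrite [X in P X](_ : _ = set0).
    rewrite measure0 mule_ge0 // lee_fin mulr_ge0 ?invr_ge0 ?sqr_ge0 //.
    by rewrite addr_ge0 ?sqr_ge0 //; exact: energy_ge0.
  apply/seteqP; split=> w //= [_ [j]]; rewrite leqn0 => /eqP->.
  by rewrite big_ord0 addr0 leNgt xl.
- apply: le_trans (measureIl _ _ _) _ => //;
    [exact: measurable_history|exact: measurable_exceeds|].
  rewrite -[leLHS]mule1; apply: lee_wpmul2l => //.
  rewrite lee_fin mulrC ler_pdivlMr ?exprn_gt0 // mul1r ler_wpDr ?energy_ge0 //.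
  by rewrite -(real_normK (num_real x)) lerXn2r ?nnegrE // ltW.
apply: le_trans (@step_mean_bound t h _ (fun g' => lam ^- 2 *
    ((x + (X (h t) g' - cond_mean (h t))) ^+ 2 + energy k g')) ig _ _) _.
- exact: measurable_exceeds.
- move=> y f b; set h' := extend _ _ _; have ig' : initial_graph m (h' t.+1).
    by rewrite /h' extendE; exact: initial_graph_add_vertex.
  apply: le_trans (_ : (P (history G t.+1 h' `&`
    exceeds lam t.+1 k (x + (X (h t) (add_vertex y f b) - cond_mean (h t)))) <= _)%E).
    apply: le_measure; rewrite ?inE.
    + by apply: measurableI; [exact: measurable_history|exact: measurable_exceeds].
    + by apply: measurableI; [exact: measurable_history|exact: measurable_exceeds].
    move=> w [Hw /= [j jk le]]; split=> //; move: Hw.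
    rewrite history_extend => -[Hw /= Gt1]; case: j jk le => [_|j jk].
      by rewrite big_ord0 addr0 leNgt xl.
    rewrite big_ord_recl /= addn0 {1}/noise Gt1 Hw // addrA => le; exists j => //.
    apply: le_trans le _; rewrite le_eqVlt; apply/orP; left; apply/eqP; congr `|_ + _|.
    by apply: eq_bigr => u _; rewrite /bump /= addnA addn1.
  have hE : h' t.+1 = add_vertex y f b by exact: extendE.
  by have := IH t.+1 h' (x + (X (h t) (add_vertex y f b) - cond_mean (h t))) ig'; rewrite hE.
apply: lee_wpmul2l => //; rewrite lee_fin step_meanZ ler_wpM2l ?invr_ge0 ?sqr_ge0 //.
exact: step_mean_sqr_noise.
Qed.

(** The maximal inequality at time [t + s] is averaged back over the [s] steps before it, whose
    noise does not enter the sums. *)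
Lemma delayed_exceeds_le lam s t h k : 0 < lam -> initial_graph m (h t) ->
  (P (history G t h `&` exceeds lam (t + s) k 0) <=
   P (history G t h) * (lam ^- 2 * delayed_energy s k (h t))%:E)%E.
Proof.
move=> lam0; elim: s t h => [|s IH] t h ig.
  by rewrite addn0 /= -[energy k (h t)]add0r -[X in X + energy _ _](expr0n R 2); exact: exceeds_le.
apply: le_trans (@step_mean_bound t h _ (fun g' => lam ^- 2 * delayed_energy s k g') ig _ _) _.
- exact: measurable_exceeds.
- move=> y f b; set h' := extend _ _ _; have hE : h' t.+1 = add_vertex y f b by exact: extendE.
  by have := IH t.+1 h'; rewrite hE addSnnS; apply; exact: initial_graph_add_vertex.
by rewrite step_meanZ.
Qed.

Lemma history0 : history G 0 (fun=> G0) = setT.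
Proof.
apply/seteqP; split=> w //= _ s; rewrite leqn0 => /eqP->.
exact: (pa_init hG).
Qed.

(** The energies [v] increase and are bounded by [phi G0], so the energy left after time [s] tends
    to 0. By the maximal inequality, so does the probability of an oscillation of given size after
    [s]; hence the partial sums are almost surely Cauchy. *)
Lemma noise_summable (phi : graph N -> R) :
  (forall g, initial_graph m g -> 0 <= phi g) ->
  (forall g y (f : {ffun 'I_m -> 'I_(nv g)}) b, initial_graph m g ->
    X g (add_vertex y f b) ^+ 2 <= phi g - phi (add_vertex y f b)) ->
  {ae P, forall w, cvgn (series (noise ^~ w))}.
Proof.
move=> phi0 phiX.
pose v k := energy k G0.
have ndv : nondecreasing_seq v.
  move=> i j ij; rewrite -(subnKC ij) /v energyD lerDl.
  exact: delayed_energy_ge0.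
have vcvg : cvgn v.
  apply: nondecreasing_is_cvgn => //; exists (phi G0) => _ [k _ <-].
  exact: energy_le.
(* [osc n s]: the noise summed from time [s] on reaches size [1 / (n + 1)]. A path outside all
   [bad n] is Cauchy. *)
pose osc n s : set T := \bigcup_k exceeds n.+1%:R^-1 s k 0.
have mosc n s : measurable (osc n s).
  by apply: bigcup_measurable => k _; exact: measurable_exceeds.
pose bad n : set T := \bigcap_s osc n s.
have mbad n : measurable (bad n) by apply: bigcap_measurable.
have exc_ge0 n : 0 < n.+1%:R^-1 :> R by rewrite invr_gt0.
have oscP n s : (P (osc n s) <= (n.+1%:R ^+ 2 * (limn v - v s))%:E)%E.
  have cvgP : (fun k => P (exceeds n.+1%:R^-1 s k 0)) @ \oo --> P (osc n s).
    apply: (@nondecreasing_cvg_mu _ _ _ P (fun k => exceeds n.+1%:R^-1 s k 0)).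
    - by move=> k; exact: measurable_exceeds.
    - exact: mosc.
    - move=> i j ij; apply/subsetPset => w [l li le]; exists l => //.
      exact: leq_trans li ij.
  rewrite -(cvg_lim _ cvgP) //; apply: lime_le; first by apply/cvg_ex; eexists; exact: cvgP.
  apply: nearW => k; rewrite -[exceeds _ _ _ _]setTI -history0.
  have := @delayed_exceeds_le _ s 0 (fun=> G0) k (exc_ge0 n) G0_init.
  rewrite add0n => /le_trans; apply; rewrite history0 probability_setT mul1e lee_fin.
  rewrite -exprVn invrK ler_wpM2l ?sqr_ge0 // lerBrDl -energyD.
  exact: (nondecreasing_cvgn_le ndv vcvg (s + k)).
have badP n : P (bad n) = 0%E.
  apply/eqP; rewrite eq_le measure_ge0 andbT.
  apply/lee_addgt0Pr => e e0; rewrite add0e.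
  have K0 : 0 < n.+1%:R ^+ 2 :> R by rewrite exprn_gt0.
  have /cvgrPdist_lt/(_ (e / n.+1%:R ^+ 2)) := vcvg.
  rewrite divr_gt0 // => /(_ isT)[s _ /(_ s (leqnn s)) /= vs].
  apply: le_trans (_ : P (osc n s) <= _)%E.
    by apply: le_measure; rewrite ?inE //; exact: bigcap_inf.
  apply: le_trans (oscP n s) _; rewrite lee_fin mulrC -ler_pdivlMr //.
  by apply: ltW; apply: le_lt_trans vs; exact: ler_norm.
have : P.-negligible (\bigcup_n bad n).
  by apply: negligible_bigcup => n; apply/negligibleP; [exact: mbad|exact: badP].
apply: negligibleS => w /= ncvg; apply: contrapT => nbad; apply: ncvg.
apply/cauchy_cvgP/cauchy_seriesP => e e0.
have [n ne] : exists n, n.+1%:R^-1 < e / 2.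
  have /cvgrPdist_lt/(_ (e / 2)) := @cvg_harmonic R.
  rewrite divr_gt0 // => /(_ isT)[n _ /(_ n (leqnn n)) /=].
  by rewrite sub0r normrN ger0_norm // => h; exists n.
have [s small] : exists s, forall j, `|\sum_(u < j) noise (s + u)%N w| < e / 2.
  apply: contrapT => /forallNP H; apply: nbad; exists n => // s _.
  have /existsNP[j /negP] := H s; rewrite -leNgt => le; exists j => //; exists j => //.
  by rewrite add0r (le_trans _ le) // ltW.
have tail j : (s <= j)%N -> `|\sum_(s <= k < j) noise k w| < e / 2.
  move=> sj; rewrite -{1}[s]add0n big_addn big_mkord.
  by under eq_bigr do rewrite addnC.
exists ([set j | (s <= j)%N], [set j | (s <= j)%N]) => /=; first by split; exists s.
move=> [a b] [/= sa sb]; have [ba|ab] := leqP b a; first by rewrite big_geq // normr0.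
have := tail a sa; have := tail b sb; rewrite (@big_cat_nat _ _ _ a s b) //=; last exact: ltnW.
set x := bigop _ _ _; set y := bigop _ _ _ => xy xs.
rewrite (splitr e) -[y](addKr x); apply: le_lt_trans (ler_normD _ _) _.
by rewrite normrN ltrD.
Qed.

End Noise.

(** The law prescribed by [pa_step] has total mass 1 on one-vertex extensions. The bound 0 on the
    probability of a bad step is carried back to time 0, and the times are countable. *)
Lemma transition_ae : {ae P, forall w, forall t, transition (G t w) (G t.+1 w)}.
Proof.
pose bad t : set T := [set w | ~ transition (G t w) (G t.+1 w)].
have mbad t : measurable (bad t).
  exact: (measurable_transition (fun g g' => ~ transition g g')).
have bad0 s t h : initial_graph m (h t) -> (P (history G t h `&` bad (t + s)%N) <= 0)%E.
  elim: s t h => [|s IH] t h ig.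
    have := @step_mean_bound t h (bad t) (fun=> 0) ig (mbad t).
    rewrite addn0 (step_mean_cst p mu_sum1 A_ge0 A_sum_gt0 _ ig) mule0; apply => y f b.
    rewrite mule0 [X in P X](_ : _ = set0) ?measure0 //.
    apply/seteqP; split=> w //=; rewrite history_extend => -[[Hw /= Gt1] nt]; apply: nt.
    by rewrite /= Gt1 Hw //; exists y, f, b.
  have := @step_mean_bound t h (bad (t + s.+1)%N) (fun=> 0) ig (mbad _).
  rewrite (step_mean_cst p mu_sum1 A_ge0 A_sum_gt0 _ ig) mule0; apply => y f b.
  rewrite mule0 -addSnnS; apply: IH; rewrite extendE; exact: initial_graph_add_vertex.
have : P.-negligible (\bigcup_t bad t).
  apply: negligible_bigcup => t; apply/negligibleP; first exact: mbad.
  apply/eqP; rewrite eq_le measure_ge0 andbT.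
  by have := bad0 t 0%N (fun=> G0) G0_init; rewrite history0 setTI add0n.
by apply: negligibleS => w /= /existsNP[t nt]; exists t.
Qed.

End Process.

(** * Deterministic recursions *)

Section Deterministic.
Variable R : realType.

Lemma harmonic_block (c K : R) (t0 : nat) : 0 < c ->
  exists n, K <= \sum_(t0 <= t < n) c * harmonic t.
Proof.
move=> c0; have ndh : nondecreasing_seq (series (@harmonic R)).
  by apply: nondecreasing_series => *; rewrite /harmonic /= invr_ge0.
have /cvgryPge/(_ (K / c + series harmonic t0))[n0 _ H] :=
  nondecreasing_dvgn_lt ndh (@dvg_harmonic R).
pose n := maxn n0 t0; have := H n (leq_maxl _ _); rewrite -lerBrDr sub_series_geq ?leq_maxr //.
move=> le; exists n; rewrite -mulr_sumr mulrC -ler_pdivrMr //.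
Qed.

Section Averaging.
Variables (x y gam e : nat -> R) (c : R).
Hypothesis rec : forall t, x t.+1 = x t + gam t * (y t - x t) + e t.
Hypothesis c_gt0 : 0 < c.
Hypothesis gam_ge : forall t, c * harmonic t <= gam t.
Hypothesis gam_le1 : \forall t \near \oo, gam t <= 1.
Hypothesis cvg_e : cvgn (series e).

(** Adding to [x] the tail of the series of [e] absorbs the noise: the sum [u] is pulled towards [y]
    up to [eps / 3]. Once [u] is above [B - 2 eps / 3] it stays there, as [gam <= 1]. It cannot stay
    below for ever, since its increments would dominate a multiple of the harmonic series. *)
Lemma averaging_ge B eps : 0 < eps -> (\forall t \near \oo, B <= y t) ->
  \forall t \near \oo, B - eps <= x t.
Proof.
move=> eps0 By; set l := limn (series e).
have d0 : 0 < eps / 3 by lra.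
pose u t := x t + (l - series e t).
have urec t : u t.+1 = u t + gam t * (y t - u t + (l - series e t)).
  rewrite /u rec seriesEnat /= big_nat_recr //=; ring.
have gam_ge0 t : 0 <= gam t.
  by apply: le_trans (gam_ge t); rewrite mulr_ge0 ?ltW // /harmonic invr_gt0.
have [t0 _ H] : \forall t \near \oo, [/\ gam t <= 1, B <= y t & `|l - series e t| < eps / 3].
  near=> t; split; near: t => //.
  exact: (cvgr_dist_lt _ _ cvg_e).
have up t : (t0 <= t)%N -> u t + gam t * (B - eps / 3 - u t) <= u t.+1.
  move=> /H[g1 yB]; rewrite ltr_norml => /andP[l1 l2]; rewrite urec lerD2l.
  apply: ler_wpM2l => //; lra.
have [[t1 [t01 ut1]]|low] := pselect (exists t1, (t0 <= t1)%N /\ B - 2 * (eps / 3) <= u t1).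
  exists t1 => // t /= t1t.
  suff ut : B - 2 * (eps / 3) <= u t.
    have [_ _] := H t (leq_trans t01 t1t); rewrite ltr_norml => /andP[_ l2].
    by move: ut; rewrite /u; lra.
  elim: t t1t => [|t IH]; first by rewrite leqn0 => /eqP e0; rewrite e0 in ut1.
  rewrite leq_eqVlt => /predU1P[<- //|]; rewrite ltnS => t1t.
  have t0t := leq_trans t01 t1t.
  apply: le_trans (up t t0t); have [g1 _ _] := H t t0t; have := IH t1t.
  have := gam_ge0 t; nra.
have low' t : (t0 <= t)%N -> u t < B - 2 * (eps / 3).
  by move=> t0t; rewrite ltNge; apply/negP => h; apply: low; exists t.
have sum_le n : (t0 <= n)%N -> u t0 + eps / 3 * \sum_(t0 <= t < n) c * harmonic t <= u n.
  elim: n => [|n IH]; first by rewrite leqn0 => /eqP ->; rewrite big_geq // mulr0 addr0.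
  rewrite leq_eqVlt => /predU1P[<-|]; first by rewrite big_geq // mulr0 addr0.
  rewrite ltnS => t0n; rewrite big_nat_recr //= mulrDr addrA.
  apply: le_trans (up n t0n); apply: lerD; first exact: IH.
  rewrite mulrC; apply: ler_pM.
  - by rewrite mulr_ge0 ?ltW // /harmonic invr_gt0.
  - exact: ltW.
  - exact: gam_ge.
  - by have := low' n t0n; lra.
have [n Hn] := harmonic_block ((B - u t0) / (eps / 3)) t0 c_gt0.
have nt0 : (t0 <= n)%N.
  rewrite leqNgt; apply/negP => lt; move: Hn; rewrite big_geq 1?ltnW //.
  rewrite ler_pdivrMr // mul0r => h; have := low' t0 (leqnn _); lra.
have := sum_le n nt0; have := low' n nt0; move: Hn; rewrite ler_pdivrMr //; lra.
Unshelve. all: by end_near.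
Qed.

End Averaging.

Section Repulsion.
Variables (I : finType) (L Q gam e : I -> nat -> R) (c del : R).
Hypothesis c_gt1 : 1 < c.
Hypothesis del_gt0 : 0 < del.
Hypothesis rec : \forall t \near \oo, forall i,
  L i t.+1 = L i t + gam i t * (Q i t / expR (L i t) - 1) + e i t.
Hypothesis gam01 : \forall t \near \oo, forall i, 0 <= gam i t <= 1.
Hypothesis cvg_e : forall i, cvgn (series (e i)).
Hypothesis Q_ge : \forall t \near \oo, forall b, 0 <= b <= del ->
  (forall i, b <= expR (L i t)) -> forall i, c * b <= Q i t.

(* As [Q i t / expR (L i t)] exceeds 1 for the index [i] minimizing
   [L i t], the minimum can only decrease through the summable noise. *)
Lemma log_bounded_below : exists B, \forall t \near \oo, forall i, B <= L i t.
Proof.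
pose l i := limn (series (e i)).
pose eps := ln c / 2.
have eps0 : 0 < eps by rewrite divr_gt0 // ln_gt0.
(* The factor [c] is split in two: one [expR eps] pays for the noise in the lower bound on all
   [L j], the other for the noise in the upper bound on [L i]. *)
have cE : expR eps * expR eps = c.
  by rewrite -expRD -splitr lnK // posrE (lt_trans _ c_gt1).
pose u i t := L i t + (l i - series (e i) t).
have [t0 _ H] : \forall t \near \oo, [/\ forall i,
    L i t.+1 = L i t + gam i t * (Q i t / expR (L i t) - 1) + e i t,
    forall i, 0 <= gam i t <= 1,
    forall i, `|l i - series (e i) t| < eps &
    forall b, 0 <= b <= del -> (forall i, b <= expR (L i t)) -> forall i, c * b <= Q i t].
  near=> t; split; near: t => //.
  apply: (@filter_forall _ _ (fun i t => `|l i - series (e i) t| < eps)) => i.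
  exact: (@cvgr_dist_lt _ _ _ _ _ _ _ (@cvg_e i) _ eps0).
(* Including [ln del] in the minimum keeps [expR (B - eps)] in the range where [Q_ge] applies. *)
pose B := \big[Num.min/ln del]_i u i t0.
have B_del : B <= ln del by apply: bigmin_le_id.
have uB n i : B <= u i (t0 + n)%N.
  elim: n i => [|n IH] i; first by rewrite addn0; exact: bigmin_le_cond.
  set t := (t0 + n)%N in IH *; have [Hrec Hgam Htail HQ] := H t (leq_addr _ _).
  rewrite addnS -/t.
  have Lu j : u j t - eps <= L j t <= u j t + eps.
    by have := Htail j; rewrite ltr_norml /u => /andP[? ?]; apply/andP; split; lra.
  have low j : expR (B - eps) <= expR (L j t).
    by rewrite ler_expR; have /andP[h _] := Lu j; have := IH j; lra.
  have bdel : 0 <= expR (B - eps) <= del.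
    rewrite expR_ge0 /= -[leRHS](lnK (x := del)) ?posrE // ler_expR; lra.
  have Qi := HQ _ bdel low i.
  (* By [1 + s <= expR s], the next value of [u i] is at least a convex combination of [u i t] and
     [B], so it stays above [B]. *)
  have ratio : 1 + (B - u i t) <= Q i t / expR (L i t).
    apply: le_trans (expR_ge1Dx _) _; rewrite ler_pdivlMr ?expR_gt0 //.
    apply: le_trans Qi; rewrite -cE -!expRD ler_expR.
    by have /andP[_ h] := Lu i; lra.
  have -> : u i t.+1 = u i t + gam i t * (Q i t / expR (L i t) - 1).
    rewrite /u Hrec seriesEnat /= big_nat_recr //=; ring.
  have /andP[g0 g1] := Hgam i; have := IH i.
  set z := _ / _ in ratio *; nra.
exists (B - eps), t0 => // t /= t0t i; rewrite -(subnKC t0t).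
have := uB (t - t0)%N i; have [_ _ Htail _] := H _ (leq_addr (t - t0) t0).
by have := Htail i; rewrite ltr_norml /u => /andP[? ?]; lra.
Unshelve. all: by end_near.
Qed.

End Repulsion.

End Deterministic.

(** * Interval maps without 2-cycles *)

Section IntervalMap.
Variable R : realType.
Implicit Types (q : {poly R}) (z : R).

(** Conjugate of [q] by [x |-> 1 - x]. It exchanges the two types, and turns statements near 1 into
    statements near 0. *)
Definition reflect_poly q : {poly R} := 1 - (q \Po (1 - 'X)).

Lemma reflect_polyE q x : (reflect_poly q).[x] = 1 - q.[1 - x].
Proof. by rewrite /reflect_poly !hornerE ?horner_comp ?hornerE.
Qed.

Lemma fixed_point01_reflect q z :
  fixed_point01 (reflect_poly q) z <-> fixed_point01 q (1 - z).
Proof.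
rewrite /fixed_point01 reflect_polyE; split=> -[/andP[z0 z1] e]; split; try lra.
Qed.

Lemma linearly_unstable_reflect q z : linearly_unstable q (1 - z) ->
  linearly_unstable (reflect_poly q) z.
Proof.
move=> [[fz uz] dz]; split; last first.
  rewrite /reflect_poly !(derivB, derivC, deriv_comp, derivX, sub0r, mulrN, mulr1, opprK).
  by rewrite horner_comp hornerD hornerN hornerX hornerC.
split; first exact/fixed_point01_reflect.
case: uz => -[ez [eta eta0 H]]; [right|left]; split; try lra; exists eta => // y /andP[y0 y1].
  rewrite reflect_polyE; have : 1 - y < q.[1 - y] by apply: H; lra.
  lra.
rewrite reflect_polyE; have : q.[1 - y] < 1 - y by apply: H; lra.
lra.
Qed.

Lemma unique_fixed_point_reflect q z : unique_fixed_point q z ->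
  unique_fixed_point (reflect_poly q) (1 - z).
Proof.
move=> [fz uz]; split.
  by apply/fixed_point01_reflect; rewrite opprB addrC subrK.
move=> x /fixed_point01_reflect fx xz; have [|x01 lx] := uz _ fx; first lra.
split; last exact: linearly_unstable_reflect.
by case: x01 => ?; [right|left]; lra.
Qed.

Lemma fixed_between (F : R -> R) a b : a <= b -> continuous F ->
  a <= F a -> F b <= b -> exists2 c, a <= c <= b & F c = c.
Proof.
move=> ab cF Fa Fb.
have [||c] := @IVT _ (fun x => F x - x) a b 0 ab.
- apply: continuous_subspaceT => x; apply: continuousB; first exact: cF.
  exact: cvg_id.
- by rewrite ge_min le_max; apply/andP; split; apply/orP; [right|left]; lra.
by rewrite in_itv /= => cab Fc; exists c => //; lra.
Qed.

(** Used for [F] equal to [q], its reflection or its second iterate. If [F x <= x] below [z], the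
    intermediate value theorem gives a fixed point of [F] in [[0, x]], which can only be 0. When
    [x > 0], repulsion at 0 would give another one away from 0, so [x = 0]. *)
Lemma below_attractor (F : R -> R) q z x : continuous F -> unique_fixed_point q z ->
  (forall c, 0 <= c <= 1 -> F c = c -> fixed_point01 q c) -> 0 <= F 0 ->
  (q.[0] = 0 -> 0 < z -> exists2 eta, 0 < eta & forall y, 0 < y < eta -> y <= F y) ->
  0 <= x < z -> F x <= x -> x = 0 /\ q.[0] = 0.
Proof.
move=> cF [[z01 _] uz] Ffix F0 near0 /andP[x0 xz] Fx.
have fix0 c : 0 <= c <= x -> F c = c -> c = 0 /\ q.[0] = 0.
  move=> cx Fc; have fc : fixed_point01 q c by apply: Ffix => //; lra.
  have cz : c <> z by move=> e; lra.
  have [[c0|c1] _] := uz c fc cz; last lra.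
  by split=> //; case: fc => _; rewrite c0.
have [x_eq0|x_gt0] : x = 0 \/ 0 < x.
  by move: x0; rewrite le_eqVlt => /predU1P[<-|]; [left|right].
  by apply: fix0; [lra|rewrite x_eq0 in Fx *; lra].
have [q0|q0] := eqVneq q.[0] 0.
  have [eta eta0 H] := near0 q0 (le_lt_trans x0 xz).
  pose y := Num.min x (eta / 2).
  have y0 : 0 < y by rewrite /y lt_min x_gt0 /=; lra.
  have yx : y <= x by rewrite /y ge_min lexx.
  have ye : y < eta by rewrite (@le_lt_trans _ _ (eta / 2)) ?ge_min ?lexx ?orbT //; lra.
  have [|c cyx Fc] := fixed_between yx cF _ Fx; first by apply: H; lra.
  by have [] := fix0 c _ Fc; lra.
have [c cyx Fc] := fixed_between x0 cF F0 Fx.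
by have [_ /eqP] := fix0 c cyx Fc; rewrite (negPf q0).
Qed.

Lemma unstable0 q z : unique_fixed_point q z -> q.[0] = 0 -> 0 < z ->
  1 < q^`().[0] /\ exists2 eta, 0 < eta & forall y, 0 < y < eta -> y < q.[y].
Proof.
move=> [_ uz] q0 z0; have [||_ [[_ u] d]] := uz 0; first by split=> //; lra.
  by move=> e; rewrite -e ltxx in z0.
split=> //; case: u => -[e]; last lra.
by move=> [eta eta0 H]; exists eta.
Qed.

(** From [q.[u] <= a <= u] follows [z <= u], and symmetrically [v <= z]. A point [w] of [[v, z]] is
    then mapped to [u], and its second iterate [q.[u]] is at most [w]; as there is no 2-cycle, this
    leaves only [w = z], which collapses the interval. *)
Lemma limit_interval q z a b u v :
  (forall x, 0 <= x <= 1 -> 0 <= q.[x] <= 1) ->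
  unique_fixed_point q z -> no_two_cycle q -> 0 <= a -> b <= 1 ->
  a <= u <= b -> q.[u] <= a -> a <= v <= b -> b <= q.[v] ->
  (q.[0] = 0 -> 0 < z -> 0 < a) -> (q.[1] = 1 -> z < 1 -> b < 1) ->
  a = z /\ b = z.
Proof.
move=> q01 uz n2 a0 b1 uab qu vab qv a_gt0 b_lt1.
have [[z01 qz] _] := uz.
have cq : continuous (horner q) by exact: continuous_horner.
have zu : z <= u.
  rewrite leNgt; apply/negP => uz'.
  have [|||||u0 q0] := @below_attractor _ q z u cq uz.
  - by [].
  - by have /andP[] : 0 <= q.[0] <= 1 by apply: q01; lra.
  - move=> q0 z0; have [_ [eta eta0 H]] := unstable0 uz q0 z0.
    by exists eta => // y /H/ltW.
  - lra.
  - lra.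
  have : 0 < a by apply: a_gt0 => //; lra.
  lra.
have vz : v <= z.
  rewrite leNgt; apply/negP => zv.
  have cq' : continuous (horner (reflect_poly q)) by exact: continuous_horner.
  have uz' := unique_fixed_point_reflect uz.
  have [|||||v0] := @below_attractor _ _ (1 - z) (1 - v) cq' uz'.
  - by [].
  - rewrite reflect_polyE; have : 0 <= q.[1 - 0] <= 1 by apply: q01; lra.
    lra.
  - move=> q0 z0; have [_ [eta eta0 H]] := unstable0 uz' q0 z0.
    by exists eta => // y /H/ltW.
  - lra.
  - have e : 1 - (1 - v) = v by lra.
    rewrite reflect_polyE e; lra.
  rewrite reflect_polyE subr0 => q1.
  have : b < 1 by apply: b_lt1; lra.
  lra.
(* Such a [w] exists because [q] is at least [b >= u] at [v] and equals [z <= u] at [z]. *)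
have [w] : exists2 w, w \in `[v, z] & q.[w] = u.
  apply: IVT => //; first exact: continuous_subspaceT.
  by rewrite qz ge_min le_max; apply/andP; split; apply/orP; [right|left]; lra.
rewrite in_itv /= => /andP[vw wz] qw.
move: wz; rewrite le_eqVlt => /predU1P[wz|wz].
  have uE : u = z by rewrite -qw wz.
  rewrite uE qz in qu; have vE : v = z by lra.
  by rewrite vE qz in qv; split; lra.
(* If [w < z], then [below_attractor] for the second iterate gives [w = 0] and [q.[0] = 0]. Then
   [v = 0], so [b <= q.[v] = 0], against [0 < z <= u <= b]. *)
have cqq : continuous (fun x => q.[q.[x]]).
  by move=> x; apply: continuous_comp; exact: continuous_horner.
have [|||||w0 q0] := @below_attractor _ q z w cqq uz.
- by move=> c c01 /n2; apply.
- have q001 : 0 <= q.[0] <= 1 by apply: q01; lra.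
  by have /andP[] := q01 _ q001.
- move=> q0 z0; have [_ [eta eta0 H]] := unstable0 uz q0 z0.
  have /cvgrPdist_lt/(_ eta eta0)[eps /= eps0 He] := cq 0.
  exists (Num.min eta eps); first by rewrite lt_min eta0.
  move=> y /andP[y0]; rewrite lt_min => /andP[ye ye'].
  have qy : y < q.[y] by apply: H; lra.
  have := He y; rewrite /ball_ /= sub0r normrN gtr0_norm // q0 sub0r normrN.
  move=> /(_ ye'); rewrite gtr0_norm; [move=> qe|lra].
  have : q.[y] < q.[q.[y]] by apply: H; lra.
  lra.
- lra.
- by rewrite qw; lra.
have v0 : v = 0 by lra.
by rewrite v0 q0 in qv; lra.
Qed.

(** By compactness the strict inequality holds on [[a, b]] with a margin, and continuity at the two
    ends carries it slightly beyond them. *)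
Lemma lower_gap q a b l : a <= b ->
  (forall x, a <= x <= b -> l < q.[x]) ->
  exists2 eta, 0 < eta & forall x, a - eta <= x <= b + eta -> l + eta <= q.[x].
Proof.
move=> ab H; have cq : continuous (horner q) by exact: continuous_horner.
have [c] := EVT_min ab (continuous_subspaceT cq); rewrite in_itv /= => cab cmin.
have /H lc := cab; pose h := (q.[c] - l) / 2.
have h0 : 0 < h by rewrite /h; lra.
have /cvgrPdist_lt/(_ h h0)[ea /= ea0 Ha] := cq a.
have /cvgrPdist_lt/(_ h h0)[eb /= eb0 Hb] := cq b.
exists (Num.min h (Num.min (ea / 2) (eb / 2))).
  by rewrite !lt_min h0 /= !divr_gt0.
set eta := Num.min _ _; have eh : eta <= h by rewrite ge_min lexx.
have eea : eta <= ea / 2 by rewrite !ge_min lexx orbT.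
have eeb : eta <= eb / 2 by rewrite !ge_min lexx !orbT.
move=> x /andP[xa xb]; have [xlta|ax] := ltP x a.
  have := Ha x; rewrite /ball_ /= ltr_norml => /(_ _)/ltr_normlP[].
    lra.
  have := cmin a; rewrite in_itv /= lexx ab => /(_ isT) qca.
  by rewrite /h in eh *; lra.
have [bltx|xb'] := ltP b x.
  have := Hb x; rewrite /ball_ /= ltr_norml => /(_ _)/ltr_normlP[].
    lra.
  have := cmin b; rewrite in_itv /= lexx ab => /(_ isT) qca.
  by rewrite /h in eh *; lra.
have := cmin x; rewrite in_itv /= ax xb' => /(_ isT) qcx.
by rewrite /h in eh; lra.
Qed.

(** Write [q = r * 'X], so that [r.[0]] is the derivative of [q] at 0. Near 0, [r] exceeds some
    [c > 1]; farther away [q] is bounded below by a positive constant, which beats [c * b] for small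
    [b]. *)
Lemma floor_near0 q be : 0 < be -> q.[0] = 0 -> 1 < q^`().[0] ->
  (forall x, 0 < x <= be -> 0 < q.[x]) ->
  exists c del, [/\ 1 < c, 0 < del &
    forall b x, 0 <= b <= del -> b <= x <= be -> c * b <= q.[x]].
Proof.
move=> be0 q0 dq pos.
have /factor_theorem[r qE] : root q 0 by apply/rootP.
have qr x : q.[x] = r.[x] * x by rewrite qE !hornerE subr0.
have r0 : 1 < r.[0].
  have {}qE : q = r * 'X by rewrite qE subr0.
  by move: dq; rewrite qE derivM derivX mulr1 hornerD hornerM hornerX mulr0 add0r.
have ge0 : 0 <= be by exact: ltW.
have cr : continuous (horner r) by exact: continuous_horner.
have [x0] := EVT_min ge0 (continuous_subspaceT cr); rewrite in_itv /= => x0b rmin.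
have rx0 : 0 < r.[x0].
  have [x0_0|x0_gt0] : x0 = 0 \/ 0 < x0.
    by case/andP: x0b; rewrite le_eqVlt => /predU1P[<-|]; [left|right].
    by rewrite x0_0; lra.
  have := pos x0; rewrite qr pmulr_lgt0 //; apply; lra.
pose c := (1 + r.[0]) / 2; pose h := (r.[0] - 1) / 2.
have h0 : 0 < h by rewrite /h; lra.
have c0 : 1 < c by rewrite /c; lra.
have /cvgrPdist_lt/(_ h h0)[eta /= eta0 H] := cr 0.
pose de := eta / 2; have de0 : 0 < de by rewrite /de; lra.
(* For [x] beyond [de], [q.[x] >= r.[x0] * de], whence the second bound on [b]. *)
exists c, (Num.min de (r.[x0] * de / c)); split=> //.
  by rewrite lt_min de0 /= divr_gt0 ?mulr_gt0 //; lra.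
move=> b x /andP[b0]; rewrite le_min => /andP[bde bc] /andP[bx xbe].
have [xde|dex] := leP x de.
  have : c <= r.[x].
    have := H x; rewrite /ball_ /= sub0r normrN ger0_norm ?(le_trans b0) // => /(_ _)/ltr_normlP[].
      by rewrite /de in xde; lra.
    by rewrite /c /h; lra.
  by rewrite qr; nra.
have rx : r.[x0] <= r.[x] by apply: rmin; rewrite in_itv /=; lra.
move: bc; rewrite ler_pdivlMr; last lra.
by rewrite qr; nra.
Qed.

End IntervalMap.

(** * Convergence of shares coupled by averaging recursions *)

Section SharesConverge.
Variable R : realType.

Lemma averaging_le (x y gam e : nat -> R) (c B eps : R) :
  (forall t, x t.+1 = x t + gam t * (y t - x t) + e t) -> 0 < c ->
  (forall t, c * harmonic t <= gam t) -> (\forall t \near \oo, gam t <= 1) ->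
  cvgn (series e) -> 0 < eps -> (\forall t \near \oo, y t <= B) ->
  \forall t \near \oo, x t <= B + eps.
Proof.
move=> rec c0 gam_ge gam_le cvge eps0 yB.
have := @averaging_ge _ (- x) (- y) gam (- e) c _ c0 gam_ge gam_le _ (- B) eps eps0.
move=> /(_ _ _ _)[].
- by move=> t; rewrite !fctE rec; ring.
- by rewrite is_cvg_seriesN.
- by near=> t; rewrite fctE lerN2; near: t.
move=> t0 _ H; exists t0 => // t /H /=; rewrite fctE; lra.
Unshelve. all: by end_near.
Qed.

Variables (I : finType) (Z W gam e : I -> nat -> R) (q : {poly R}) (z : R) (c : I -> R).
Hypothesis Z01 : forall i t, 0 <= Z i t <= 1.
Hypothesis W_mean : forall t lo hi, (forall i, lo <= Z i t <= hi) ->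
  forall i, lo <= W i t <= hi.
Hypothesis rec : forall i t, Z i t.+1 = Z i t + gam i t * (q.[W i t] - Z i t) + e i t.
Hypothesis c_gt0 : forall i, 0 < c i.
Hypothesis gam_ge : forall i t, c i * harmonic t <= gam i t.
Hypothesis gam_le1 : forall i, \forall t \near \oo, gam i t <= 1.
Hypothesis cvg_e : forall i, cvgn (series (e i)).

Lemma shares_ge B eps : 0 < eps -> (\forall t \near \oo, forall i, B <= q.[W i t]) ->
  \forall t \near \oo, forall i, B - eps <= Z i t.
Proof.
move=> eps0 By; apply: (@filter_forall _ _ (fun i t => B - eps <= Z i t)) => i.
apply: (averaging_ge (rec i) (c_gt0 i) (gam_ge i) (gam_le1 i) (@cvg_e i) eps0).
by near=> t; near: t; apply: filterS By => t; exact.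
Unshelve. all: by end_near.
Qed.

Lemma shares_le B eps : 0 < eps -> (\forall t \near \oo, forall i, q.[W i t] <= B) ->
  \forall t \near \oo, forall i, Z i t <= B + eps.
Proof.
move=> eps0 By; apply: (@filter_forall _ _ (fun i t => Z i t <= B + eps)) => i.
apply: (averaging_le (rec i) (c_gt0 i) (gam_ge i) (gam_le1 i) (@cvg_e i) eps0).
by apply: filterS By => t; exact.
Qed.

(** By compactness the maximum of [q] is below 1, and averaging brings the shares below any larger
    level. *)
Lemma shares_bounded_away1 : (forall x, 0 <= x <= 1 -> q.[x] < 1) ->
  exists2 be, be < 1 & \forall t \near \oo, forall i, Z i t <= be.
Proof.
move=> q1; have cq : continuous (horner q) by exact: continuous_horner.
have [x] := EVT_max (@ler01 R) (continuous_subspaceT cq); rewrite in_itv /= => x01 qx.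
have x1 := q1 x x01.
exists (q.[x] + (1 - q.[x]) / 2); first by lra.
apply: shares_le; first by lra.
apply: nearW => t i; apply: qx; rewrite in_itv /=.
by apply: W_mean => j; exact: Z01.
Qed.

Hypothesis q01 : forall x, 0 <= x <= 1 -> 0 <= q.[x] <= 1.
Hypothesis uz : unique_fixed_point q z.
Hypothesis n2 : no_two_cycle q.
Hypothesis away0 : q.[0] = 0 -> 0 < z ->
  exists2 be, 0 < be & \forall t \near \oo, forall i, be <= Z i t.
Hypothesis away1 : q.[1] = 1 -> z < 1 ->
  exists2 be, be < 1 & \forall t \near \oo, forall i, Z i t <= be.

(* With [a] and [b] the limits inferior and superior of the shares over all
   communities, averaging gives [a >= min q] and [b <= max q] over [a, b]. *)
Lemma shares_converge i : Z i t @[t --> \oo] --> z.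
Proof.
pose Lo : set R := [set x | \forall t \near \oo, forall j, x <= Z j t].
pose Hi : set R := [set x | \forall t \near \oo, forall j, Z j t <= x].
have Lo0 : Lo 0 by apply: nearW => t j; have /andP[] := Z01 j t.
have Hi1 : Hi 1 by apply: nearW => t j; have /andP[] := Z01 j t.
have LoHi x y : Lo x -> Hi y -> x <= y.
  move=> [t0 _ H0] [t1 _ H1]; pose t := maxn t0 t1.
  exact: le_trans (H0 t (leq_maxl _ _) i) (H1 t (leq_maxr _ _) i).
have supLo : has_sup Lo by split; [exists 0|exists 1 => x /LoHi; apply].
have infHi : has_inf Hi by split; [exists 1|exists 0 => x; apply: LoHi].
pose a := sup Lo; pose b := inf Hi.
have a0 : 0 <= a by apply: ub_le_sup => //; case: supLo.
have b1 : b <= 1 by apply: ge_inf => //; case: infHi.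
have Lo_le x : Lo x -> x <= a by move=> h; apply: ub_le_sup => //; case: supLo.
have Hi_ge x : Hi x -> b <= x by move=> h; apply: ge_inf => //; case: infHi.
have ab : a <= b.
  apply: ge_sup; first by exists 0.
  by move=> x Lx; apply: lb_le_inf; [exists 1|move=> y; exact: LoHi].
have Lo_lt eps : 0 < eps -> Lo (a - eps).
  move=> eps0; have [x Lx ax] := sup_adherent eps0 supLo.
  by apply: filterS Lx => t H j; apply: le_trans (H j); exact: ltW.
have Hi_lt eps : 0 < eps -> Hi (b + eps).
  move=> eps0; have [x Lx ax] := inf_adherent eps0 infHi.
  by apply: filterS Lx => t H j; apply: le_trans (H j) _; exact: ltW.
have Wab eps : 0 < eps -> \forall t \near \oo, forall j, a - eps <= W j t <= b + eps.
  move=> eps0; near=> t => j; apply: W_mean => k; apply/andP; split; move: k; near: t.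
    exact: Lo_lt.
  exact: Hi_lt.
(* Otherwise [q] exceeds [a] on all of [[a, b]], and [lower_gap] followed by averaging puts
   [a + eta / 2] in [Lo], against [a] being its supremum. *)
have [u uab qu] : exists2 u, a <= u <= b & q.[u] <= a.
  apply: contrapT => H.
  have [x xab|eta eta0 gap] := @lower_gap _ q a b a ab.
    by rewrite ltNge; apply/negP => le; apply: H; exists x.
  have : Lo (a + eta - eta / 2).
    apply: shares_ge; first lra.
    by apply: filterS (Wab _ eta0) => t Wt j; apply: gap.
  by move/Lo_le; lra.
(* The same argument for the upper limit, with [- q] in [lower_gap]. *)
have [v vab qv] : exists2 v, a <= v <= b & b <= q.[v].
  apply: contrapT => H.
  have [x xab|eta eta0 gap] := @lower_gap _ (- q) a b (- b) ab.
    by rewrite hornerN ltrN2 ltNge; apply/negP => le; apply: H; exists x.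
  have : Hi (b - eta + eta / 2).
    apply: shares_le; first lra.
    by apply: filterS (Wab _ eta0) => t Wt j; have := gap _ (Wt j); rewrite hornerN; lra.
  by move/Hi_ge; lra.
have [az bz] : a = z /\ b = z.
  apply: (@limit_interval _ q z a b u v) => //.
    by move=> q0 z0; have [be be0 /Lo_le] := away0 q0 z0; lra.
  by move=> q1 z1; have [be be1 /Hi_ge] := away1 q1 z1; lra.
apply/cvgrPdist_le => eps eps0; near=> t; rewrite ler_distl.
apply/andP; split.
  rewrite lerBlDr -bz; move: i; near: t; exact: Hi_lt.
rewrite -lerBlDr -az; move: i; near: t; exact: Lo_lt.
Unshelve. all: by end_near.
Qed.

End SharesConverge.

(** * Shares of the communities *)

Section Shares.
Variables (R : realType) (N m : nat) (mu : 'I_N -> R) (A : 'M[R]_N).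
Variable p : 'I_m.+1 -> R.
Hypotheses (m_gt0 : (0 < m)%N) (mu_gt0 : forall i, 0 < mu i).
Hypothesis mu_sum1 : \sum_(i < N) mu i = 1.
Hypotheses (A_ge0 : forall x y, 0 <= A x y) (A_sum_gt0 : forall y, 0 < \sum_(x < N) A x y).
Hypothesis p01 : forall k, 0 <= p k <= 1.
Implicit Types (g : graph N) (Q : pred ('I_N * bool)) (i : 'I_N) (b : bool).

Definition comm_deg g i : R := (mass g (in_comm i))%:R.
Definition part_deg g i b : R := (mass g (in_part i b))%:R.
Definition share g i b : R := part_deg g i b / comm_deg g i.
Definition type_pick g i b : R := pick_prob A g i (in_type b).
(** Reflecting the polynomial for blue lets the blue share obey the same recursion as the red one,
    so that repulsion is proved once, at 0, for both types. *)
Definition type_poly b : {poly R} := if b then rule_poly p else reflect_poly (rule_poly p).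

Lemma eq_mass g Q Q' : Q =1 Q' -> mass g Q = mass g Q'.
Proof. by move=> e; apply: eq_bigl => v; rewrite e. Qed.

Lemma red_shareE g i : red_share R g i = share g i true.
Proof.
rewrite /red_share /share /part_deg /comm_deg /mass; congr (_%:R / _).
by apply: eq_bigl => v; rewrite /in_part andbC eqb_id.
Qed.

Lemma sum_part_deg g i : \sum_b part_deg g i b = comm_deg g i.
Proof.
rewrite big_bool /= /part_deg /comm_deg -natrD -massU.
  congr (_%:R); apply: eq_mass => -[x c]; rewrite /in_part /in_comm /=.
  by case: c; rewrite ?andbT ?andbF ?orbF.
by case=> x [] /=; rewrite /in_part /= ?andbF ?andbT.
Qed.

Lemma comm_deg_ge1 g i : initial_graph m g -> 1 <= comm_deg g i.
Proof. by move=> ig; rewrite ler1n; exact: comm_mass_gt0 ig. Qed.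

Lemma part_deg_ge0 g i b : 0 <= part_deg g i b. Proof. exact: ler0n. Qed.

Lemma part_le_comm_deg g i b : part_deg g i b <= comm_deg g i.
Proof.
rewrite -sum_part_deg big_bool /=.
by case: b; rewrite ?lerDl ?lerDr part_deg_ge0.
Qed.

Lemma part_degN g i b : part_deg g i (~~ b) = comm_deg g i - part_deg g i b.
Proof. by rewrite -sum_part_deg big_bool /=; case: b => /=; lra. Qed.

Lemma share_mulE g i b : initial_graph m g -> share g i b * comm_deg g i = part_deg g i b.
Proof. by move=> ig; rewrite /share divfK // gt_eqF // (lt_le_trans ltr01) ?comm_deg_ge1. Qed.

Lemma share01 g i b : initial_graph m g -> 0 <= share g i b <= 1.
Proof.
move=> ig; have D0 : 0 < comm_deg g i by rewrite (lt_le_trans ltr01) ?comm_deg_ge1.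
by rewrite /share divr_ge0 ?part_deg_ge0 ?(ltW D0) //= ler_pdivrMr // mul1r part_le_comm_deg.
Qed.

Lemma shareN g i b : initial_graph m g -> share g i (~~ b) = 1 - share g i b.
Proof.
move=> ig; have D0 : 0 < comm_deg g i by rewrite (lt_le_trans ltr01) ?comm_deg_ge1.
by rewrite /share part_degN mulrBl divff // gt_eqF.
Qed.

Lemma type_pickE g i b :
  type_pick g i b = (\sum_x A x i * part_deg g x b) / attach_weight A g i.
Proof.
rewrite /type_pick pick_probE; congr (_ / _); apply: eq_bigr => x _.
by congr (_ * _%:R); apply: eq_mass => l; rewrite /in_type /in_comm /in_part andbC.
Qed.

Lemma type_pickN g i b : initial_graph m g -> type_pick g i (~~ b) = 1 - type_pick g i b.
Proof.
move=> ig; rewrite -(pick_probC A_ge0 A_sum_gt0 i (in_type b) ig) /pick_prob; apply: eq_bigl => v.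
by rewrite /in_type /=; case: b; case: (label v).2.
Qed.

(** The pick probability is the average of the shares with weights [A x i * comm_deg g x]. *)
Lemma type_pick_mean g lo hi b : initial_graph m g ->
  (forall x, lo <= share g x b <= hi) -> forall i, lo <= type_pick g i b <= hi.
Proof.
move=> ig lohi i; have S0 := attach_weight_gt0 A_ge0 A_sum_gt0 i ig.
rewrite type_pickE ler_pdivlMr // ler_pdivrMr // attach_weightE !mulr_sumr.
apply/andP; split; apply: ler_sum => x _; rewrite mulrCA ler_wpM2l // -(share_mulE x b ig);
  by rewrite ler_wpM2r ?ler0n //; have /andP[] := lohi x.
Qed.

Lemma type_polyE g i b : initial_graph m g ->
  type_rule p b (red_pick A g i) = (type_poly b).[type_pick g i b].
Proof.
move=> ig; case: b => //=; rewrite /type_rule reflect_polyE.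
have -> : 1 - type_pick g i false = type_pick g i true.
  by rewrite (@type_pickN g i true) //; lra.
by [].
Qed.

Lemma type_poly_horner b x : (type_poly b).[x] = type_rule p b (if b then x else 1 - x).
Proof. by case: b => //; rewrite /type_poly reflect_polyE. Qed.

Lemma type_prob01 k b : 0 <= type_prob p k b <= 1.
Proof. by case: b => /=; have := p01 (inord k); lra. Qed.

Lemma type_rule01 b w : 0 <= w <= 1 -> 0 <= type_rule p b w <= 1.
Proof.
move=> /andP[w0 w1].
have ge0 c : 0 <= type_rule p c w.
  rewrite -type_ruleE; apply: sumr_ge0 => k _.
  have /andP[t0 _] := type_prob01 k c.
  by rewrite !mulr_ge0 ?exprn_ge0 // subr_ge0.
rewrite ge0 /=; have := ge0 (~~ b); have := type_rule_sum p w; rewrite big_bool /=.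
by case: b => /=; lra.
Qed.

Lemma type_poly01 b x : 0 <= x <= 1 -> 0 <= (type_poly b).[x] <= 1.
Proof. by move=> x01; rewrite type_poly_horner type_rule01 //; case: b; lra. Qed.

(** In the Bernstein form, all coefficients are nonnegative and all basis terms positive inside the
    interval. A zero there kills every coefficient, hence the polynomial. *)
Lemma type_poly_gt0 b x0 x : (type_poly b).[x0] != 0 -> 0 < x < 1 -> 0 < (type_poly b).[x].
Proof.
rewrite !type_poly_horner; set w0 := if b then _ else _; set w := if b then _ else _.
move=> nz x01; have w01 : 0 < w < 1 by rewrite /w; case: (b); lra.
have /andP[ge0 _] : 0 <= type_rule p b w <= 1 by apply: type_rule01; lra.
rewrite lt_neqAle ge0 andbT eq_sym; apply: contra_neq nz => z; rewrite -type_ruleE.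
apply: big1 => k _; suff -> : type_prob p k b = 0 by rewrite mulr0.
have coef : 0 < 'C(m, k)%:R * w ^+ k * (1 - w) ^+ (m - k).
  by rewrite !mulr_gt0 ?exprn_gt0 ?ltr0n ?bin_gt0 ?leq_ord //; lra.
have ter (j : 'I_m.+1) : true -> 0 <= 'C(m, j)%:R * w ^+ j * (1 - w) ^+ (m - j) * type_prob p j b.
  move=> _; have /andP[t0 _] := type_prob01 j b.
  by rewrite !mulr_ge0 ?exprn_ge0 //; lra.
move: z; rewrite -type_ruleE => /(psumr_eq0P ter)/(_ k isT)/eqP.
by rewrite mulf_eq0 (gt_eqF coef) /= => /eqP.
Qed.

Lemma part_deg_step g (y : 'I_N) (f : {ffun 'I_m -> 'I_(nv g)}) c i b : initial_graph m g ->
  part_deg (add_vertex y f c) i b = part_deg g i b +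
    (m * in_part i b (y, c) + \sum_(j < m) in_part i b (label (f j)))%:R.
Proof. by move=> ig; rewrite /part_deg mass_add_vertex // natrD. Qed.

Lemma comm_deg_step g (y : 'I_N) (f : {ffun 'I_m -> 'I_(nv g)}) c i : initial_graph m g ->
  comm_deg (add_vertex y f c) i = comm_deg g i +
    (m * in_comm i (y, c) + \sum_(j < m) in_comm i (label (f j)))%:R.
Proof. by move=> ig; rewrite /comm_deg mass_add_vertex // natrD. Qed.

Definition max_step : R := (2 * m)%:R.

Lemma step_le (Q : pred ('I_N * bool)) g (y : 'I_N) (f : {ffun 'I_m -> 'I_(nv g)}) c :
  0 <= ((m * Q (y, c) + \sum_(j < m) Q (label (f j)))%:R : R) <= max_step.
Proof.
rewrite ler0n ler_nat mul2n -addnn leq_add //; first by case: (Q _); rewrite ?muln1 ?muln0.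
by rewrite -[leqRHS]card_ord -sum1_card leq_sum // => j _; case: (Q _).
Qed.

Lemma part_deg_step_le g (y : 'I_N) (f : {ffun 'I_m -> 'I_(nv g)}) c i b : initial_graph m g ->
  0 <= part_deg (add_vertex y f c) i b - part_deg g i b <= max_step.
Proof. by move=> ig; rewrite part_deg_step // addrAC subrr add0r; exact: step_le. Qed.

Lemma comm_deg_step_le g (y : 'I_N) (f : {ffun 'I_m -> 'I_(nv g)}) c i : initial_graph m g ->
  0 <= comm_deg (add_vertex y f c) i - comm_deg g i <= max_step.
Proof. by move=> ig; rewrite comm_deg_step // addrAC subrr add0r; exact: step_le. Qed.

(** The truncation at 1 keeps the value meaningful for an empty part; the constant is the one
    required by [sqr_ratio_le]. *)
Definition potential (x : R) : R := max_step * (1 + max_step) / Num.max x 1.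

Lemma max_step_ge0 : 0 <= max_step. Proof. exact: ler0n. Qed.

Lemma potential_ge0 x : 0 <= potential x.
Proof.
have := max_step_ge0 => M0; rewrite /potential divr_ge0 ?mulr_ge0 ?addr_ge0 //.
by rewrite le_max ler01 orbT.
Qed.

Lemma potential_le x x' : x <= x' -> potential x' <= potential x.
Proof.
move=> xx; have := max_step_ge0 => M0; rewrite /potential ler_wpM2l ?mulr_ge0 ?addr_ge0 //.
have max_gt0 t : 0 < Num.max t 1 :> R by rewrite lt_max ltr01 orbT.
by rewrite lef_pV2 ?posrE ?max_gt0 // ge_max !le_max xx lexx orbT.
Qed.

(** With [h = x' - x] and [M = max_step], the right side is [M (1 + M) h / (x x')]. It suffices that
    [h x' <= M (1 + M) x], which holds as [h <= M] and [x' <= x + M <= (1 + M) x]. *)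
Lemma sqr_ratio_le x x' : 1 <= x -> 0 <= x' - x <= max_step ->
  ((x' - x) / x) ^+ 2 <= potential x - potential x'.
Proof.
move=> x1 /andP[d0 dM]; have x'1 : 1 <= x' by lra.
rewrite /potential !(max_idPl _) //; set M := max_step in dM *.
have [x0 x'0] : x != 0 /\ x' != 0 by split; rewrite gt_eqF //; lra.
rewrite -subr_ge0.
have -> : M * (1 + M) / x - M * (1 + M) / x' - ((x' - x) / x) ^+ 2 =
    (x' - x) * (M * (1 + M) * x - (x' - x) * x') / (x ^+ 2 * x').
  by field; rewrite x0 x'0.
rewrite divr_ge0 //; last by rewrite mulr_ge0 ?sqr_ge0 //; lra.
rewrite mulr_ge0 // subr_ge0 -mulrA.
have : (x' - x) * x' <= M * ((1 + M) * x) by apply: ler_pM => //; nra.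
by [].
Qed.

Definition part_growth i b g g' : R := (part_deg g' i b - part_deg g i b) / part_deg g i b.
Definition comm_growth i g g' : R := (comm_deg g' i - comm_deg g i) / comm_deg g i.
(** First-order part of the change of the share: the old degree is kept in the denominator so that
    the conditional mean is explicit. *)
Definition share_drift i b g g' : R :=
  ((part_deg g' i b - part_deg g i b) - share g i b * (comm_deg g' i - comm_deg g i)) /
  comm_deg g i.
(** Indicator that the part of community [i] of type [b] stops being empty. This happens at most
    once, so the indicator of emptiness serves as its potential. *)
Definition birth i b g g' : R := ((part_deg g i b == 0) && (part_deg g' i b != 0))%:R.

Lemma part_deg0V1 g i b : part_deg g i b = 0 \/ 1 <= part_deg g i b.
Proof.
rewrite /part_deg; case: (mass _ _) => [|n]; [by left|right].
by rewrite ler1n.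
Qed.

Section Step.
Variables (g : graph N) (y : 'I_N) (f : {ffun 'I_m -> 'I_(nv g)}) (c : bool).
Hypothesis ig : initial_graph m g.
Let g' := add_vertex y f c.

Lemma part_growth_sqr i b :
  part_growth i b g g' ^+ 2 <= potential (part_deg g i b) - potential (part_deg g' i b).
Proof.
have d01 := @part_deg_step_le g y f c i b ig.
rewrite /part_growth; have [e|ge1] := part_deg0V1 g i b.
  (* Division by 0 gives 0, so for an empty part only the monotonicity of the potential is at
     stake. *)
  rewrite {1 2}e invr0 mulr0 expr0n /= subr_ge0 potential_le //.
  by have := d01; rewrite -/g'; lra.
exact: sqr_ratio_le.
Qed.

Lemma comm_growth_sqr i :
  comm_growth i g g' ^+ 2 <= potential (comm_deg g i) - potential (comm_deg g' i).
Proof. by apply: sqr_ratio_le; [exact: comm_deg_ge1|exact: comm_deg_step_le]. Qed.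

Lemma part_le_comm_step i b :
  part_deg g' i b - part_deg g i b <= comm_deg g' i - comm_deg g i.
Proof.
rewrite -!sum_part_deg !big_bool /=.
have := @part_deg_step_le g y f c i true ig; have := @part_deg_step_le g y f c i false ig.
by rewrite -/g'; case: b; lra.
Qed.

Lemma share_drift_le i b :
  `|(part_deg g' i b - part_deg g i b) - share g i b * (comm_deg g' i - comm_deg g i)| <=
  comm_deg g' i - comm_deg g i.
Proof.
have /andP[r0 _] := @part_deg_step_le g y f c i b ig.
have /andP[d0 _] := @comm_deg_step_le g y f c i ig.
have rd := part_le_comm_step i b; have /andP[z0 z1] := share01 i b ig.
rewrite -/g' in r0 d0 *; set r := _ - _ in r0 rd *; set e := _ - _ in d0 rd *.
by rewrite ler_norml; apply/andP; split; nra.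
Qed.

Lemma share_drift_sqr i b :
  share_drift i b g g' ^+ 2 <= potential (comm_deg g i) - potential (comm_deg g' i).
Proof.
apply: le_trans (comm_growth_sqr i); have D1 := comm_deg_ge1 i ig.
rewrite /share_drift /comm_growth -real_normK ?num_real // lerXn2r ?nnegrE //.
  have /andP[d0 _] := @comm_deg_step_le g y f c i ig.
  by rewrite divr_ge0 //; lra.
rewrite normrM [X in _ * X]ger0_norm ?invr_ge0; last lra.
by rewrite ler_wpM2r ?invr_ge0 ?share_drift_le //; lra.
Qed.

Lemma birth_sqr i b :
  birth i b g g' ^+ 2 <= (part_deg g i b == 0)%:R - (part_deg g' i b == 0)%:R.
Proof.
have := @part_deg_step_le g y f c i b ig; rewrite -/g' /birth => /andP[d0 _].
have [e|ne] := eqVneq (part_deg g i b) 0;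
  have [e'|_] := eqVneq (part_deg g' i b) 0 => /=; rewrite ?andbF /=; try lra.
have [e|] := part_deg0V1 g i b; last by lra.
by rewrite e eqxx in ne.
Qed.

(** The exact change of the share has the new degree in its denominator; replacing it by the old one
    costs at most the squared relative growth, which the potential absorbs. *)
Lemma share_step i b : `|share g' i b - share g i b - share_drift i b g g'| <=
  potential (comm_deg g i) - potential (comm_deg g' i).
Proof.
apply: le_trans (comm_growth_sqr i); rewrite /share_drift /comm_growth.
have := share_drift_le i b; have /andP[d0 _] := @comm_deg_step_le g y f c i ig.
have D1 := comm_deg_ge1 i ig; have := share_mulE i b ig.
rewrite -/g' in d0 *; rewrite [share g' i b]/share.
set D := comm_deg g i in d0 D1 *; set D' := comm_deg g' i in d0 *.
set Z := share g i b; set r := part_deg g i b; set r' := part_deg g' i b => Zr le.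
have [D0 D'0] : D != 0 /\ D' != 0 by split; rewrite gt_eqF //; lra.
have -> : r' / D' - Z - (r' - r - Z * (D' - D)) / D =
    - ((r' - r - Z * (D' - D)) * ((D' - D) / (D * D'))).
  by rewrite -Zr; field; rewrite D0 D'0.
have w0 : 0 <= (D' - D) / (D * D') by rewrite divr_ge0 ?mulr_ge0 //; lra.
rewrite normrN normrM (ger0_norm w0) expr_div_n.
apply: (@le_trans _ _ ((D' - D) * ((D' - D) / (D * D')))); first by rewrite ler_wpM2r.
rewrite mulrA -expr2 ler_wpM2l ?sqr_ge0 // lef_pV2 ?posrE; nra.
Qed.

Lemma step_mean_part i b :
  step_mean mu A p (fun y0 (f0 : {ffun 'I_m -> 'I_(nv g)}) c0 =>
    part_deg (add_vertex y0 f0 c0) i b - part_deg g i b) =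
  m%:R * mu i * (type_poly b).[type_pick g i b] + part_deg g i b * pick_rate m mu A g i.
Proof. by rewrite -type_polyE //; exact: step_mean_mass. Qed.

Lemma step_mean_comm i :
  step_mean mu A p (fun y0 (f0 : {ffun 'I_m -> 'I_(nv g)}) c0 =>
    comm_deg (add_vertex y0 f0 c0) i - comm_deg g i) =
  m%:R * mu i + comm_deg g i * pick_rate m mu A g i.
Proof.
rewrite (@eq_step_mean _ _ _ _ _ _ _ _ (fun y0 (f0 : {ffun 'I_m -> 'I_(nv g)}) c0 =>
  (part_deg (add_vertex y0 f0 c0) i true - part_deg g i true) +
  (part_deg (add_vertex y0 f0 c0) i false - part_deg g i false))); last first.
  by move=> y0 f0 c0; rewrite -!sum_part_deg !big_bool /=; lra.
rewrite step_meanD !step_mean_part -!type_polyE // -sum_part_deg big_bool /= /type_rule.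
ring.
Qed.

Definition gain i : R := m%:R * mu i / comm_deg g i.

Lemma cond_mean_part_growth i b : part_deg g i b != 0 ->
  cond_mean mu A p (part_growth i b) g =
  gain i * ((type_poly b).[type_pick g i b] / share g i b) + pick_rate m mu A g i.
Proof.
move=> S0; rewrite /cond_mean /part_growth.
rewrite (@eq_step_mean _ _ _ _ _ _ _ _ (fun y0 (f0 : {ffun 'I_m -> 'I_(nv g)}) c0 =>
  (part_deg g i b)^-1 * (part_deg (add_vertex y0 f0 c0) i b - part_deg g i b))); last first.
  by move=> *; rewrite mulrC.
rewrite step_meanZ step_mean_part /gain /share.
have D0 : comm_deg g i != 0 by rewrite gt_eqF // (lt_le_trans ltr01) ?comm_deg_ge1.
by field; rewrite S0 D0.
Qed.

Lemma cond_mean_comm_growth i :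
  cond_mean mu A p (comm_growth i) g = gain i + pick_rate m mu A g i.
Proof.
rewrite /cond_mean /comm_growth.
rewrite (@eq_step_mean _ _ _ _ _ _ _ _ (fun y0 (f0 : {ffun 'I_m -> 'I_(nv g)}) c0 =>
  (comm_deg g i)^-1 * (comm_deg (add_vertex y0 f0 c0) i - comm_deg g i))); last first.
  by move=> *; rewrite mulrC.
rewrite step_meanZ step_mean_comm /gain.
have D0 : comm_deg g i != 0 by rewrite gt_eqF // (lt_le_trans ltr01) ?comm_deg_ge1.
by field; rewrite D0.
Qed.

(** The picks raise the part and the whole community at the same rate, so [pick_rate] cancels and
    only the own ends of the new vertex remain. *)
Lemma cond_mean_share_drift i b :
  cond_mean mu A p (share_drift i b) g =
  gain i * ((type_poly b).[type_pick g i b] - share g i b).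
Proof.
rewrite /cond_mean /share_drift.
rewrite (@eq_step_mean _ _ _ _ _ _ _ _ (fun y0 (f0 : {ffun 'I_m -> 'I_(nv g)}) c0 =>
  (comm_deg g i)^-1 * (part_deg (add_vertex y0 f0 c0) i b - part_deg g i b) +
  (- (share g i b / comm_deg g i)) * (comm_deg (add_vertex y0 f0 c0) i - comm_deg g i))); last first.
  by move=> *; ring.
rewrite step_meanD !step_meanZ step_mean_comm step_mean_part /gain /share.
have D0 : comm_deg g i != 0 by rewrite gt_eqF // (lt_le_trans ltr01) ?comm_deg_ge1.
by field; rewrite D0.
Qed.

(** A new vertex of community [i] and type [b] brings [m > 0] ends, which already makes the part
    nonempty. *)
Lemma cond_mean_birth i b : part_deg g i b = 0 ->
  mu i * (type_poly b).[type_pick g i b] <= cond_mean mu A p (birth i b) g.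
Proof.
move=> S0; rewrite -type_polyE //.
have -> : mu i * type_rule p b (red_pick A g i) = step_mean mu A p
    (fun y0 (f0 : {ffun 'I_m -> 'I_(nv g)}) c0 => ((y0 == i) && (c0 == b))%:R).
  rewrite (@step_mean_label _ _ _ _ _ _ _ _ _ (fun y0 c0 => ((y0 == i) && (c0 == b))%:R)) //.
  rewrite (bigD1 i) //= [X in _ + X]big1 ?addr0; last first.
    by move=> x /negPf xi; rewrite big1 ?mulr0 // => k _; rewrite xi mulr0.
  rewrite (bigD1 b) //= [X in _ + X]big1 ?addr0 ?eqxx ?mulr1 //.
  by move=> k /negPf kb; rewrite kb andbF mulr0.
apply: step_mean_le => // y0 f0 c0; rewrite /birth S0 eqxx /= ler_nat.
case: eqP => //= ->; case: eqP => //= ->.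
rewrite part_deg_step // S0 add0r pnatr_eq0 /in_part !eqxx muln1.
by rewrite addn_eq0 negb_and -lt0n m_gt0.
Qed.

End Step.

(** With [h] the relative increment, [h - h ^+ 2 <= h / (1 + h) <= ln (1 + h) <= h]; the middle
    inequality is the last one applied to the inverse of [1 + h]. *)
Lemma ln_step (x x' : R) : 0 < x -> x <= x' ->
  `|ln x' - ln x - (x' - x) / x| <= ((x' - x) / x) ^+ 2.
Proof.
move=> x0 xx'; set h := (x' - x) / x.
have h0 : 0 <= h by rewrite /h divr_ge0 //; lra.
have x'E : x' = x * (1 + h) by rewrite /h; field; rewrite gt_eqF.
have -> : ln x' - ln x = ln (1 + h).
  by rewrite x'E lnM ?posrE; [ring|lra|lra].
have up : ln (1 + h) <= h by apply: le_ln1Dx; lra.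
have low : h - h ^+ 2 <= ln (1 + h).
  have := @le_ln1Dx _ (- (h / (1 + h))).
  have -> : 1 + - (h / (1 + h)) = (1 + h)^-1 by field; rewrite gt_eqF //; lra.
  rewrite lnV ?posrE; last lra.
  have hd : h / (1 + h) < 1 by rewrite ltr_pdivrMr; lra.
  have : h - h ^+ 2 <= h / (1 + h) by rewrite ler_pdivlMr; nra.
  move=> h1 h2; have : - ln (1 + h) <= - (h / (1 + h)) by apply: h2; lra.
  lra.
by rewrite ler_norml; apply/andP; split; lra.
Qed.

End Shares.

(** * Almost every path *)

Lemma summable_telescope (R : realType) (a phi : nat -> R) :
  (forall t, 0 <= phi t) -> (forall t, `|a t| <= phi t - phi t.+1) -> cvgn (series a).
Proof.
move=> phi0 le; apply: normed_cvg; apply: nondecreasing_is_cvgn.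
  by apply: nondecreasing_series => *; exact: normr_ge0.
exists (phi 0%N) => _ [n _ <-]; apply: (@le_trans _ _ (phi 0%N - phi n)); last first.
  by rewrite lerBlDr lerDl.
rewrite /normed_series_of seriesEnat /=; elim: n => [|n IH]; first by rewrite big_geq // subrr.
by rewrite big_nat_recr //=; have := le n; lra.
Qed.

Lemma cvg_series_block (R : realType) (a : nat -> R) : cvgn (series a) ->
  exists t0, forall s n, (t0 <= s)%N -> (s <= n)%N -> `|\sum_(s <= t < n) a t| < 1.
Proof.
move=> /cvgrPdist_lt/(_ (1 / 2)); rewrite divr_gt0 // => /(_ isT)[t0 _ H].
exists t0 => s n t0s sn; rewrite -sub_series_geq //.
have := H s t0s; have := H n (leq_trans t0s sn) => /=; rewrite !ltr_norml; lra.
Qed.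

Section Path.
Variables (R : realType) (N m : nat) (mu : 'I_N -> R) (A : 'M[R]_N).
Variable p : 'I_m.+1 -> R.
Hypotheses (m_gt0 : (0 < m)%N) (mu_gt0 : forall i, 0 < mu i).
Hypothesis mu_sum1 : \sum_(i < N) mu i = 1.
Hypotheses (A_ge0 : forall x y, 0 <= A x y) (A_sum_gt0 : forall y, 0 < \sum_(x < N) A x y).
Hypothesis p01 : forall k, 0 <= p k <= 1.
Variable g : nat -> graph N.
Hypothesis g0_init : initial_graph m (g 0%N).
Hypothesis g_step : forall t, transition m (g t) (g t.+1).

Definition path_noise (X : graph N -> graph N -> R) t : R :=
  X (g t) (g t.+1) - cond_mean mu A p X (g t).

Hypothesis cvg_drift : forall i b, cvgn (series (path_noise (share_drift R i b))).
Hypothesis cvg_part : forall i b, cvgn (series (path_noise (part_growth R i b))).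
Hypothesis cvg_comm : forall i, cvgn (series (path_noise (comm_growth R i))).
Hypothesis cvg_birth : forall i b, cvgn (series (path_noise (birth R i b))).

Let Z i b t : R := share R (g t) i b.
Let W i b t : R := type_pick A (g t) i b.
Let D i t : R := comm_deg R (g t) i.
Let S i b t : R := part_deg R (g t) i b.
Let q b := type_poly p b.
Let gam i t : R := gain m mu (g t) i.

Lemma path_init t : initial_graph m (g t).
Proof.
elim: t => [//|t IH]; have [y [f [b ->]]] := g_step t.
exact: initial_graph_add_vertex.
Qed.

Lemma path_nv t : nv (g t) = (nv (g 0%N) + t)%N.
Proof.
elim: t => [|t IH]; first by rewrite addn0.
by have [y [f [b ->]]] := g_step t; rewrite nv_add_vertex IH addnS.
Qed.

Lemma path_part_step i b t : 0 <= S i b t.+1 - S i b t <= max_step R m.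
Proof.
rewrite /S; have ig := path_init t; have [y [f [c ->]]] := g_step t.
exact: part_deg_step_le.
Qed.

Lemma path_comm_step i t : 0 <= D i t.+1 - D i t <= max_step R m.
Proof.
rewrite /D; have ig := path_init t; have [y [f [c ->]]] := g_step t.
exact: comm_deg_step_le.
Qed.

Lemma path_part_mono i b s t : (s <= t)%N -> S i b s <= S i b t.
Proof.
move=> st; rewrite -(subnKC st); elim: (t - s)%N => [|n IH]; first by rewrite addn0.
by rewrite addnS; have := path_part_step i b (s + n); lra.
Qed.

Lemma path_comm_mono i s t : (s <= t)%N -> D i s <= D i t.
Proof.
move=> st; rewrite -(subnKC st); elim: (t - s)%N => [|n IH]; first by rewrite addn0.
by rewrite addnS; have := path_comm_step i (s + n); lra.
Qed.

Lemma path_comm_ge1 i t : 1 <= D i t.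
Proof. exact: comm_deg_ge1 (path_init t). Qed.

Let total t : R := (2 * (m * nv (g t)))%:R.

Lemma path_comm_le i t : D i t <= total t.
Proof. by rewrite /D /comm_deg /total ler_nat -(mass_total (path_init t)) mass_le. Qed.

Lemma path_nv0_gt0 (i : 'I_N) : (0 < nv (g 0%N))%N.
Proof. by have [_ _ _ /(_ i)[v _]] := g0_init; apply: leq_trans (ltn_ord v). Qed.

(** The total degree grows linearly in time; the form with [harmonic] uses that there is an initial
    vertex. *)
Lemma path_total_le (i : 'I_N) t : (total t)^-1 >= (total 0)^-1 * harmonic t.
Proof.
have n0 := path_nv0_gt0 i.
have total_gt0 k : 0 < total k.
  by rewrite /total ltr0n !muln_gt0 m_gt0 path_nv /= addn_gt0 n0.
have le : total t <= total 0 * t.+1%:R.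
  rewrite /total -natrM ler_nat path_nv -!mulnA !leq_mul //.
  by rewrite mulnS leq_add // leq_pmull.
have rhs0 : 0 < total 0 * t.+1%:R by apply: mulr_gt0; [exact: total_gt0|rewrite ltr0n].
by rewrite /harmonic /= -invfM lef_pV2 ?posrE; [exact: le|exact: rhs0|exact: total_gt0].
Qed.

Lemma path_gain_ge i t : m%:R * mu i * (total 0)^-1 * harmonic t <= gam i t.
Proof.
have mm : 0 <= m%:R * mu i by rewrite mulr_ge0 ?ler0n // ltW.
rewrite /gam /gain -mulrA ler_wpM2l //; apply: le_trans (path_total_le i t) _.
rewrite lef_pV2 ?posrE; first exact: path_comm_le.
  by apply: lt_le_trans (path_comm_le i t); apply: lt_le_trans (path_comm_ge1 i t).
by apply: lt_le_trans (path_comm_ge1 i t).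
Qed.

Lemma path_gain_ge0 i t : 0 <= gam i t.
Proof.
apply: le_trans (path_gain_ge i t).
by rewrite !mulr_ge0 ?invr_ge0 ?ler0n // ltW.
Qed.

Lemma path_rate_coef_gt0 (i : 'I_N) : 0 < m%:R * mu i * (total 0)^-1.
Proof.
by rewrite !mulr_gt0 ?invr_gt0 ?ltr0n ?muln_gt0 ?m_gt0 ?path_nv0_gt0.
Qed.

Lemma pick_rate_ge0 t i : 0 <= pick_rate m mu A (g t) i.
Proof.
rewrite /pick_rate mulr_ge0 ?ler0n // sumr_ge0 // => y _; apply: mulr_ge0; first exact: ltW.
by apply: divr_ge0 => //; apply: ltW; exact: attach_weight_gt0 (path_init t).
Qed.

(** Once the degree reaches [m], the gain is at most [mu i]. If it stayed below [m], the gain would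
    be at least [mu i] at each step while the total growth is bounded, so the partial sums of the
    noise of [comm_growth] would tend to minus infinity. *)
Lemma path_gain_le1 i : \forall t \near \oo, gam i t <= 1.
Proof.
have mu1 : mu i <= 1.
  rewrite -mu_sum1 (bigD1 i) //= lerDl sumr_ge0 // => j _; exact: ltW.
suff [t0 Dm] : exists t0, m%:R <= D i t0.
  exists t0 => // t /= t0t; rewrite /gam /gain ler_pdivrMr ?mul1r.
    have := path_comm_mono i t0t; have := mu_gt0 i; have := ler0n R m.
    by rewrite /D in Dm *; nra.
  by apply: lt_le_trans (path_comm_ge1 i t).
apply: contrapT => /forallNP Dlt.
have lt t : D i t < m%:R by rewrite ltNge; apply/negP.
have [t0 bound] := cvg_series_block (@cvg_comm i).
have term t : path_noise (comm_growth R i) t <= (D i t.+1 - D i t) - mu i.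
  rewrite /path_noise cond_mean_comm_growth //; last exact: path_init.
  have := pick_rate_ge0 t i; have D1 := path_comm_ge1 i t; have := lt t.
  have /andP[d0 _] := path_comm_step i t.
  have gm : mu i <= gain m mu (g t) i.
    rewrite /gain ler_pdivlMr ?(lt_le_trans ltr01) // mulrC ler_wpM2r ?(ltW (mu_gt0 _)) //.
    exact: ltW (lt t).
  have : comm_growth R i (g t) (g t.+1) <= D i t.+1 - D i t.
    by rewrite /comm_growth ler_pdivrMr ?(lt_le_trans ltr01) // ler_peMr.
  lra.
have sum n : \sum_(t0 <= t < t0 + n) path_noise (comm_growth R i) t <=
    (D i (t0 + n)%N - D i t0) - n%:R * mu i.
  elim: n => [|n IH]; first by rewrite addn0 big_geq // subrr mul0r subr0.
  rewrite addnS big_nat_recr ?leq_addr //=; have := term (t0 + n)%N.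
  by rewrite -natr1; lra.
have [n nmu] : exists n : nat, (m%:R + 1) / mu i < n%:R.
  exists (Num.Def.archi_bound ((m%:R + 1) / mu i)).
  by apply: archi_boundP; rewrite divr_ge0 ?addr_ge0 // ltW.
rewrite ltr_pdivrMr // in nmu.
have := sum n; have := bound t0 (t0 + n)%N (leqnn _) (leq_addr _ _).
rewrite ltr_norml => /andP[lo _]; have := lt (t0 + n)%N; have := path_comm_ge1 i t0.
lra.
Qed.

Definition share_error i b t : R := Z i b t.+1 - Z i b t - gam i t * ((q b).[W i b t] - Z i b t).

Lemma share_rec i b t :
  Z i b t.+1 = Z i b t + gam i t * ((q b).[W i b t] - Z i b t) + share_error i b t.
Proof. by rewrite /share_error; ring. Qed.

(** The error is the centred drift, convergent by hypothesis, plus the second-order correction of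
    [share_step], whose absolute values telescope. *)
Lemma cvg_share_error i b : cvgn (series (share_error i b)).
Proof.
pose corr t := Z i b t.+1 - Z i b t - share_drift R i b (g t) (g t.+1).
rewrite (_ : share_error i b = path_noise (share_drift R i b) + corr).
  apply: is_cvg_seriesD; first exact: cvg_drift.
  apply: (@summable_telescope _ _ (fun t => potential m (D i t))) => t; first exact: potential_ge0.
  rewrite /corr /Z /D; have ig := path_init t; have [y [f [c ->]]] := g_step t.
  exact: share_step.
apply/funext => t; rewrite fctE /corr /path_noise.
rewrite (cond_mean_share_drift mu p A_ge0 A_sum_gt0 (path_init t)).
by rewrite /share_error -/(gam i t) -/(q b) -/(W i b t) -/(Z i b t); ring.
Qed.

Let L i b t : R := ln (S i b t) - ln (D i t).

Lemma expR_log_share i b t : 0 < S i b t -> expR (L i b t) = Z i b t.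
Proof.
move=> S0; have D0 : 0 < D i t by apply: lt_le_trans (path_comm_ge1 i t).
by rewrite /L -ln_div ?posrE // lnK ?posrE ?divr_gt0.
Qed.

(** The correction is set to 0 while the part is empty, so that the series converges in all cases;
    [log_rec] is only claimed for a nonempty part. *)
Definition log_error i b t : R :=
  path_noise (part_growth R i b) t +
  (if S i b t == 0 then 0 else ln (S i b t.+1) - ln (S i b t) - part_growth R i b (g t) (g t.+1)) -
  (path_noise (comm_growth R i) t +
   (ln (D i t.+1) - ln (D i t) - comm_growth R i (g t) (g t.+1))).

Lemma cvg_log_error i b : cvgn (series (log_error i b)).
Proof.
apply: (@is_cvg_seriesB _ (fun t => path_noise (part_growth R i b) t + _)
  (fun t => path_noise (comm_growth R i) t + _)).
  apply: (@is_cvg_seriesD _ (path_noise (part_growth R i b))); first exact: cvg_part.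
  apply: (@summable_telescope _ _ (fun t => potential m (S i b t))) => t; first exact: potential_ge0.
  have /andP[d0 _] := path_part_step i b t.
  case: eqP => [_|/eqP Snz]; first by rewrite normr0 subr_ge0 potential_le // -subr_ge0.
  have S1 : 0 < S i b t by rewrite lt_neqAle eq_sym Snz /S part_deg_ge0.
  apply: le_trans (ln_step S1 _) _; first by rewrite -subr_ge0.
  rewrite /S; have ig := path_init t; have [y [f [c e]]] := g_step t; rewrite e.
  exact: (part_growth_sqr R y f c ig i b).
apply: (@is_cvg_seriesD _ (path_noise (comm_growth R i))); first exact: cvg_comm.
apply: (@summable_telescope _ _ (fun t => potential m (D i t))) => t; first exact: potential_ge0.
have /andP[d0 _] := path_comm_step i t.
have D1 : 0 < D i t by apply: lt_le_trans (path_comm_ge1 i t).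
apply: le_trans (ln_step D1 _) _; first by rewrite -subr_ge0.
rewrite /D; have ig := path_init t; have [y [f [c e]]] := g_step t; rewrite e.
exact: (comm_growth_sqr R y f c ig i).
Qed.

Lemma log_rec i b t : 0 < S i b t ->
  L i b t.+1 = L i b t + gam i t * ((q b).[W i b t] / expR (L i b t) - 1) + log_error i b t.
Proof.
move=> S0; rewrite (expR_log_share S0) /log_error /path_noise.
rewrite (cond_mean_part_growth mu p A_ge0 A_sum_gt0 (path_init t)) ?gt_eqF //.
rewrite (cond_mean_comm_growth mu p A_ge0 A_sum_gt0 (path_init t)).
rewrite -/(gam i t) -/(q b) -/(W i b t) -/(Z i b t) /L.
by ring.
Qed.

Let W_mean b t lo hi : (forall i, lo <= Z i b t <= hi) -> forall i, lo <= W i b t <= hi.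
Proof. by move=> H; exact: (type_pick_mean A_ge0 A_sum_gt0 (path_init t) H). Qed.

Let Z01 b i t : 0 <= Z i b t <= 1.
Proof. exact: share01 (path_init t). Qed.

(** The repulsion from 0 is only asked at the values taken by [W], since the polynomial may vanish
    at 1. *)
Definition floored b : Prop := exists c del, [/\ 1 < c, 0 < del &
  \forall t \near \oo, forall x i, 0 <= x <= del -> x <= W i b t -> c * x <= (q b).[W i b t]].

Lemma type_polyN b x : (type_poly p (~~ b)).[x] = 1 - (type_poly p b).[1 - x].
Proof.
case: b => /=; rewrite ?reflect_polyE //.
have e : 1 - (1 - x) = x by lra.
by rewrite e; lra.
Qed.

(** [floor_near0] needs [W] to stay where the polynomial is positive. If it is nonzero at 1, all of
    [(0, 1]] will do. If it vanishes at 1, it is below 1 on [[0, 1]], so the shares stay away from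
    1. *)
Lemma path_floored b x0 : (q b).[0] = 0 -> 1 < (q b)^`().[0] -> (q b).[x0] != 0 -> floored b.
Proof.
move=> q0 dq qx0.
have pos x : 0 < x < 1 -> 0 < (q b).[x] by exact: type_poly_gt0 qx0.
have q01 x : 0 <= x <= 1 -> 0 <= (q b).[x] <= 1 by exact: type_poly01.
have [be be01 Wbe] : exists2 be, 0 < be &
    (\forall t \near \oo, forall i, W i b t <= be) /\ (forall x, 0 < x <= be -> 0 < (q b).[x]).
  have [q1|q1] := eqVneq (q b).[1] 0.
    have q_lt1 x : 0 <= x <= 1 -> (q b).[x] < 1.
      move=> /andP[]; rewrite le_eqVlt => /predU1P[<-|x_gt0]; first by rewrite q0.
      rewrite le_eqVlt => /predU1P[->|x_lt1]; first by rewrite q1.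
      have := @type_poly_gt0 _ _ p p01 (~~ b) 1 (1 - x).
      rewrite !type_polyN subrr q0 subr0 oner_eq0 => /(_ isT).
      have -> : 1 - (1 - x) = x by lra.
      rewrite -/(q b) => H; have : 0 < 1 - (q b).[x] by apply: H; lra.
      lra.
    have [be be1 Hbe] := @shares_bounded_away1 _ _ (Z^~ b) (W^~ b) gam
        (share_error^~ b) (q b) _ (Z01 b) (@W_mean b) (share_rec^~ b)
        path_rate_coef_gt0 path_gain_ge path_gain_le1 (cvg_share_error^~ b) q_lt1.
    exists (Num.max be (1 / 2)).
      by rewrite lt_max; apply/orP; right; lra.
    split; last first.
      move=> x /andP[x_gt0 xm]; apply: pos; rewrite x_gt0 /=.
      by apply: le_lt_trans xm _; rewrite gt_max be1 /=; lra.
    apply: filterS Hbe => t H i.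
    have Zbe j : 0 <= Z j b t <= be by have /andP[z0 _] := Z01 b j t; rewrite z0 H.
    by have /andP[_ h] := W_mean Zbe i; rewrite le_max h.
  exists 1 => //; split.
    by apply: nearW => t i; have /andP[_] := @W_mean b t 0 1 (fun j => Z01 b j t) i.
  move=> x /andP[x_gt0]; rewrite le_eqVlt => /predU1P[->|x1]; last by apply: pos; rewrite x_gt0.
  have /andP[q1_ge0 _] : 0 <= (q b).[1] <= 1 by apply: q01; rewrite ler01 lexx.
  by rewrite lt_neqAle eq_sym q1.
have [c [del [c1 del0 H]]] := floor_near0 be01 q0 dq Wbe.2.
exists c, del; split=> //; apply: filterS Wbe.1 => t Ht x i x01 xW.
by apply: H => //; rewrite xW Ht.
Qed.

(** One end of type [b] in [x] contributes [A x i], against a weight of at most the column sum times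
    the total degree, which is linear in [t]. *)
Lemma type_pick_ge x i b t : 1 <= S x b t ->
  A x i * (\sum_y A y i)^-1 * (total 0)^-1 * harmonic t <= W i b t.
Proof.
move=> S1; have ig := path_init t.
have aw0 := attach_weight_gt0 A_ge0 A_sum_gt0 i ig.
rewrite /W type_pickE ler_pdivlMr //.
apply: (@le_trans _ _ (A x i * S x b t)); last first.
  rewrite [leRHS](bigD1 x) //= lerDl sumr_ge0 // => y _.
  by rewrite mulr_ge0 ?part_deg_ge0.
apply: (@le_trans _ _ (A x i * 1)); last by rewrite ler_wpM2l.
have total_gt0 : 0 < total t.
  by apply: lt_le_trans (path_comm_le i t); apply: lt_le_trans (path_comm_ge1 i t).
set aw := attach_weight A (g t) i in aw0 *.
have aw_le : aw <= (\sum_y A y i) * total t.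
  rewrite /aw attach_weightE mulr_suml; apply: ler_sum => y _.
  by rewrite ler_wpM2l //; exact: path_comm_le.
have sA := A_sum_gt0 i; set s := \sum_y A y i in sA aw_le *.
pose h := (total 0)^-1 * harmonic t.
have h0 : 0 <= h by rewrite mulr_ge0 ?invr_ge0 ?ler0n.
have h_le : h * aw <= s.
  have -> : s = (total t)^-1 * (s * total t) by rewrite mulrCA mulVf ?mulr1 ?gt_eqF.
  by apply: ler_pM => //; [exact: ltW|exact: path_total_le].
have -> : A x i * s^-1 * (total 0)^-1 * harmonic t * aw = A x i * (s^-1 * (h * aw)).
  by rewrite /h !mulrA.
by rewrite ler_wpM2l // mulrC ler_pdivrMr // mul1r.
Qed.

(** A conditional Borel-Cantelli argument: while the part of [i] is empty, a birth has conditional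
    probability at least a multiple of [harmonic t]. If none ever came, the noise of [birth] would
    sum to minus infinity. *)
Lemma part_birth x i b : floored b -> 0 < A x i -> (exists t, 0 < S x b t) ->
  exists t, 0 < S i b t.
Proof.
move=> [c [del [c1 del0 [t1 _ H]]]] Axi [t2 S2]; apply: contrapT => /forallNP noS.
have S0 t : S i b t = 0.
  by apply/eqP; rewrite eq_le part_deg_ge0 andbT leNgt; apply/negP.
pose ka := A x i * (\sum_y A y i)^-1 * (total 0)^-1.
have ka0 : 0 < ka.
  by rewrite !mulr_gt0 ?invr_gt0 ?ltr0n ?muln_gt0 ?m_gt0 ?(path_nv0_gt0 i).
(* The cap by [del] keeps [k' * harmonic t], a lower bound of [W], in the range of [floored]. *)
pose k' := Num.min del ka; have k'0 : 0 < k' by rewrite lt_min del0.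
have har01 t : 0 <= (harmonic t : R) <= 1.
  by rewrite /harmonic /= invr_ge0 ler0n /= invf_le1 ?ler1n ?ltr0n.
have [t3 bound] := cvg_series_block (@cvg_birth i b).
pose t0 := maxn t3 (maxn t1 t2).
have term t : (t0 <= t)%N -> path_noise (birth R i b) t <= - (mu i * k' * harmonic t).
  rewrite !geq_max => /andP[_ /andP[t1t t2t]].
  have Sx : 1 <= S x b t.
    have [e|//] := part_deg0V1 R (g t) x b.
    by have := path_part_mono x b t2t; rewrite [S x b t]e leNgt S2.
  have /andP[har0 har1] := har01 t.
  have k'ka : k' <= ka by rewrite ge_min lexx orbT.
  have k'del : k' <= del by rewrite ge_min lexx.
  have Wk : k' * harmonic t <= W i b t.
    by apply: le_trans (type_pick_ge i Sx); rewrite ler_wpM2r.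
  have kd : 0 <= k' * harmonic t <= del by
    rewrite mulr_ge0 ?(ltW k'0) //=; apply: le_trans k'del; rewrite ler_piMr // ltW.
  have := H t t1t _ i kd Wk.
  have := cond_mean_birth m_gt0 mu_gt0 A_ge0 A_sum_gt0 p01 (path_init t) (S0 t).
  rewrite /path_noise /birth -/(S i b t) -/(S i b t.+1) !S0 eqxx /= sub0r lerN2.
  rewrite -/(q b) -/(W i b t) => h1 h2; apply: le_trans h1.
  have /andP[kd0 _] := kd; rewrite -mulrA ler_wpM2l ?(ltW (mu_gt0 _)) //.
  by apply: le_trans h2; rewrite ler_peMl // ltW.
have [n Hn] := @harmonic_block R (mu i * k') 2 t0 (mulr_gt0 (mu_gt0 i) k'0).
have t0n : (t0 <= n)%N.
  rewrite leqNgt; apply/negP => lt; move: Hn; rewrite big_geq; last exact: ltnW.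
  lra.
have := bound t0 n (leq_maxl _ _) t0n; rewrite ltr_norml => /andP[lo _].
have : \sum_(t0 <= t < n) path_noise (birth R i b) t <=
    \sum_(t0 <= t < n) - (mu i * k' * harmonic t).
  rewrite big_nat_cond [leRHS]big_nat_cond; apply: ler_sum => t /andP[/andP[h _] _].
  exact: term.
by rewrite sumrN; lra.
Qed.

(** The type travels backwards along the path from [i] to the community of [v], one [part_birth] per
    edge. *)
Lemma part_reached b i : floored b -> type_reaches A (g 0%N) b i -> exists t, 0 < S i b t.
Proof.
move=> fl [v [rv /connectP[pth]]]; elim: pth i => [|x pth IH] i /=.
  move=> _ e; exists 0%N; rewrite /S /part_deg ltr0n /mass (bigD1 v) /=.
    by rewrite ltn_addr //; have [_ _ dg _] := g0_init; exact: dg.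
  by rewrite /in_part -/(community v) -/(red v) e rv !eqxx.
move=> /andP[Axi pth'] e; apply: part_birth fl Axi _; exact: IH.
Qed.

(** All parts are eventually nonempty, so logarithms make sense; since [W] is at least the least
    share, [floored] supplies the repulsion that keeps the logarithms bounded below. *)
Lemma share_away0 b x0 : (q b).[0] = 0 -> 1 < (q b)^`().[0] -> (q b).[x0] != 0 ->
  (forall i, type_reaches A (g 0%N) b i) ->
  exists2 be, 0 < be & \forall t \near \oo, forall i, be <= Z i b t.
Proof.
move=> q0 dq qx0 reach; have fl := path_floored q0 dq qx0.
have Spos : \forall t \near \oo, forall i, 0 < S i b t.
  apply: (@filter_forall _ _ (fun i t => 0 < S i b t)) => i.
  have [t0 S0] := part_reached fl (reach i).
  by exists t0 => // t /= t0t; apply: lt_le_trans S0 (path_part_mono _ _ t0t).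
have [c [del [c1 del0 H]]] := fl.
have [||||B HB] := @log_bounded_below _ _ (L^~ b) (fun i t => (q b).[W i b t]) gam
    (log_error^~ b) c del c1 del0.
- by apply: filterS Spos => t St i; exact: log_rec.
- apply: (@filter_forall _ _ (fun i t => 0 <= gam i t <= 1)) => i.
  by apply: filterS (path_gain_le1 i) => t ->; rewrite path_gain_ge0.
- by move=> i; exact: cvg_log_error.
- apply: filterS2 Spos H => t St Ht x x01 xL i; apply: Ht => //.
  have Zx j : x <= Z j b t <= 1.
    by have := xL j; rewrite expR_log_share // => ->; have /andP[] := Z01 b j t.
  by have /andP[] := W_mean Zx i.
exists (expR B); first exact: expR_gt0.
by apply: filterS2 Spos HB => t St Ht i; rewrite -expR_log_share // ler_expR.
Qed.

(** The limit 0 is excluded by [share_away0] for red, and the limit 1 by the same lemma for blue;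
    [z] and [1 - z] witness that the respective polynomials are not zero. *)
Lemma path_share_converge z :
  unique_fixed_point (rule_poly p) z -> no_two_cycle (rule_poly p) ->
  (fixed_point01 (rule_poly p) 0 -> z <> 0 -> forall y, type_reaches A (g 0%N) true y) ->
  (fixed_point01 (rule_poly p) 1 -> z <> 1 -> forall y, type_reaches A (g 0%N) false y) ->
  forall i, Z i true t @[t --> \oo] --> z.
Proof.
move=> uz n2 hred hblue i; have [[z01 qz] _] := uz.
apply: (@shares_converge _ _ (Z^~ true) (W^~ true) gam (share_error^~ true) (rule_poly p) z _
  (Z01 true) (@W_mean true) (share_rec^~ true) path_rate_coef_gt0 path_gain_ge path_gain_le1
  (cvg_share_error^~ true)) => //.
- exact: (@type_poly01 _ _ p p01 true).
- move=> q0 z0; have [dq _] := unstable0 uz q0 z0.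
  apply: (@share_away0 true z) => //; first by rewrite /q /= qz gt_eqF.
  by apply: hred; [split=> //; lra|move=> e; lra].
move=> q1 z1; have uz' := unique_fixed_point_reflect uz.
have r0 : (reflect_poly (rule_poly p)).[0] = 0 by rewrite reflect_polyE subr0 q1 subrr.
have [|dq _] := unstable0 uz' r0; first lra.
have [||be be0 H] := @share_away0 false (1 - z) r0 dq.
- have e : 1 - (1 - z) = z by lra.
  by rewrite /q /= reflect_polyE e qz gt_eqF //; lra.
- by apply: hblue; [split=> //; lra|move=> e; lra].
exists (1 - be); first lra.
apply: filterS H => t H j; have := H j; rewrite /Z (@shareN R N m (g t) j true (path_init t)); lra.
Qed.

End Path.

(** About [hred] and [hblue]: if the rule fixes 0 and no red vertex can influence a community, that
    community almost surely gains no red vertex and its share stays 0. They exclude this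
    obstruction, and its mirror image at 1, when the claimed limit is different. *)
Theorem theorem3p4 (R : realType) (N m : nat) (mu : 'I_N -> R) (A : 'M[R]_N)
    (p : 'I_m.+1 -> R) (G0 : graph N)
    (d : measure_display) (T : measurableType d) (P : probability T R)
    (G : nat -> T -> graph N) (zstar : R)
    (hm : (0 < m)%N)
    (hmu0 : forall i, 0 < mu i) (hmu1 : \sum_(i < N) mu i = 1)
    (hA0 : forall x y, 0 <= A x y) (hA1 : forall y, 0 < \sum_(x < N) A x y)
    (hp : forall k, 0 <= p k <= 1)
    (hG0 : initial_graph m G0)
    (hG : pa_process mu A p G0 P G)
    (hfix : unique_fixed_point (rule_poly p) zstar)
    (hcycle : no_two_cycle (rule_poly p))
    (hred : fixed_point01 (rule_poly p) 0 -> zstar <> 0 ->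
      forall y, type_reaches A G0 true y)
    (hblue : fixed_point01 (rule_poly p) 1 -> zstar <> 1 ->
      forall y, type_reaches A G0 false y) :
  {ae P, forall w, forall i : 'I_N,
    (fun t => red_share R (G t w) i) @ \oo --> zstar}.
Proof.
(* The path argument uses finitely many noises, so their exceptional null sets are merged before a
   path is fixed. *)
have ae_all (I : finType) (X : I -> graph N -> graph N -> R) (phi : I -> graph N -> R) :
    (forall i g, initial_graph m g -> 0 <= phi i g) ->
    (forall i g y (f : {ffun 'I_m -> 'I_(nv g)}) b, initial_graph m g ->
      X i g (add_vertex y f b) ^+ 2 <= phi i g - phi i (add_vertex y f b)) ->
    {ae P, forall w, forall i, cvgn (series (noise mu A p G (X i) ^~ w))}.
  move=> phi0 phiX; apply: filter_forall => i.
  exact: (noise_summable hm hmu0 hmu1 hA0 hA1 hp hG0 hG (phi0 i) (phiX i)).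
have drift := @ae_all _ (fun ib : 'I_N * bool => share_drift R ib.1 ib.2)
  (fun ib g => potential m (comm_deg R g ib.1))
  (fun ib g _ => potential_ge0 _ _) (fun ib g y f b ig => share_drift_sqr R y f b ig ib.1 ib.2).
have part := @ae_all _ (fun ib : 'I_N * bool => part_growth R ib.1 ib.2)
  (fun ib g => potential m (part_deg R g ib.1 ib.2))
  (fun ib g _ => potential_ge0 _ _) (fun ib g y f b ig => part_growth_sqr R y f b ig ib.1 ib.2).
have comm := @ae_all _ (fun i : 'I_N => comm_growth R i)
  (fun i g => potential m (comm_deg R g i))
  (fun i g _ => potential_ge0 _ _) (fun i g y f b ig => comm_growth_sqr R y f b ig i).
have birth := @ae_all _ (fun ib : 'I_N * bool => birth R ib.1 ib.2)
  (fun ib g => (part_deg R g ib.1 ib.2 == 0)%:R)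
  (fun ib g _ => ler0n _ _) (fun ib g y f b ig => birth_sqr R y f b ig ib.1 ib.2).
have step := transition_ae hm hmu1 hA0 hA1 hG0 hG.
apply: filterS (filterI step (filterI drift (filterI part (filterI comm birth)))).
move=> w [/= stepw [driftw [partw [commw birthw]]]] i.
have G0w : G 0%N w = G0 := pa_init hG w.
rewrite (_ : (fun t => _) = (fun t => share R (G t w) i true)); last first.
  by apply/funext => t; exact: red_shareE.
apply: (@path_share_converge R N m mu A p hm hmu0 hmu1 hA0 hA1 hp (G^~ w)) => //.
- by rewrite G0w.
- by move=> j b; exact: (driftw (j, b)).
- by move=> j b; exact: (partw (j, b)).
- by move=> j b; exact: (birthw (j, b)).
- by rewrite G0w.
- by rewrite G0w.
Qed.
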